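(* Let $H$ be a separable infinite dimensional complex Hilbert space, let $B(H)$ be the algebra of all bounded linear operators on $H$, and let ${}^{tr}$ denote the transpose with respect to an arbitrary but fixed complete orthonormal sequence in $H$. Suppose that $\phi:B(H)\to B(H)$ is a linear bijection which preserves the idempotents of infinite rank and infinite corank in both directions, i.e., for every $P\in B(H)$, $P$ is an idempotent of infinite rank and infinite corank if and only if $\phi(P)$ is an idempotent of infinite rank and infinite corank. Then there is an invertible operator $A\in B(H)$ such that either \[ \phi(T)=ATA^{-1} \quad \text{for all } T\in B(H), \] or \[ \phi(T)=AT^{tr}A^{-1} \quad \text{for all } T\in B(H). \]
   Context: An idempotent is an operator $P\in B(H)$ with $P^2=P$ (not necessarily self-adjoint). An operator $A\in B(H)$ has infinite rank and infinite corank if the Hilbert space dimensions of $\overline{\operatorname{rng} A}$ and of $\overline{\operatorname{rng} A}^{\perp}$ are both infinite, where $\operatorname{rng} A$ is the range of $A$. The transpose of $T\in B(H)$ with respect to a complete orthonormal sequence $(e_n)$ in $H$ is the operator $T^{tr}\in B(H)$ determined by $\langle T^{tr}e_i,e_j\rangle=\langle Te_j,e_i\rangle$ for all $i,j$. *)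

(* Defs.v *)
From HB Require Import structures.
From mathcomp Require Import all_boot all_order all_algebra.
From mathcomp Require Import complex.
From mathcomp Require Import all_classical all_reals.
From mathcomp Require Import topology normedtype.

Set Implicit Arguments.
Unset Strict Implicit.
Unset Printing Implicit Defensive.

Import Order.TTheory GRing.Theory Num.Theory.
Import numFieldNormedType.Exports.

Local Open Scope classical_set_scope.
Local Open Scope complex_scope.
Local Open Scope ring_scope.

(* The inner product is linear in its first argument and conjugate-linear in
   its second one, and it induces the norm. *)
HB.mixin Record CompleteNormedModule_isHilbert (R : realType) H
    & CompleteNormedModule R[i] H := {
  inner : {dot H for (@Num.conj R[i])};
  inner_normE : forall x : H, inner x x = `|x| ^+ 2
}.

#[short(type="hilbertType")]
HB.structure Definition Hilbert (R : realType) :=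
  {H of CompleteNormedModule R[i] H & CompleteNormedModule_isHilbert R H}.

Notation "'[ x , y ]" := (inner x y) : ring_scope.

Definition separable_space (T : topologicalType) : Prop :=
  exists2 D : set T, countable D & dense D.

Section Dimension.
Context (R : realType) (H : hilbertType R).
Implicit Types (B M : set H) (e : nat -> H).

Definition linear_span B : set H :=
  [set x | exists (n : nat) (a : 'I_n -> R[i]) (b : 'I_n -> H),
     (forall i, B (b i)) /\ x = \sum_(i < n) a i *: b i].

Definition orthonormal_set B : Prop :=
  forall x y, B x -> B y -> '[x, y] = (x == y)%:R.

(* For a closed subspace [M]. *)
Definition hilbert_basis M B : Prop :=
  orthonormal_set B /\ closure (linear_span B) = M.

(* The Hilbert space dimension of [M] is the cardinality of its Hilbert bases. *)
Definition infinite_dimension M : Prop :=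
  exists2 B, hilbert_basis M B & infinite_set B.

Definition orthogonal_complement M : set H :=
  [set y | forall x, M x -> '[x, y] = 0].

Definition complete_orthonormal_seq e : Prop :=
  (forall i j, '[e i, e j] = (i == j)%:R) /\
  closure (linear_span (range e)) = setT.

End Dimension.

Section BoundedOperators.
Context (R : realType) (H : hilbertType R).

Definition bounded_operator : {pred H -> H} := [pred T : H -> H |
  `[< linear T /\ exists M : R, forall x, `|T x| <= M%:C * `|x| >] ].

Record bop : Type := Bop {
  bop_fun :> H -> H;
  bop_funP : bop_fun \in bounded_operator
}.

HB.instance Definition _ := [isSub for bop_fun].
HB.instance Definition _ := [Choice of bop by <:].

Lemma bounded_operatorP (T : H -> H) :
  reflect (linear T /\ exists M : R, forall x, `|T x| <= M%:C * `|x|)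
          (T \in bounded_operator).
Proof. exact: asboolP. Qed.

Lemma bounded_operator_submod : submod_closed bounded_operator.
Proof.
split.
  apply/bounded_operatorP; split; first by move=> a x y; rewrite scaler0 addr0.
  by exists 0 => x; rewrite normr0 mul0r.
move=> a S T /bounded_operatorP[linS [M SM]] /bounded_operatorP[linT [N TN]].
apply/bounded_operatorP; split.
  move=> b x y.
  rewrite [LHS]/(a *: S (b *: x + y) + T (b *: x + y)) linS linT.
  rewrite [RHS]/(b *: (a *: S x + T x) + (a *: S y + T y)).
  rewrite !scalerDr !scalerA [a * b]mulrC.
  exact: addrACA.
exists (complex.Re `|a| * M + N) => x.
have aE : (complex.Re `|a|)%:C = `|a| by apply/RRe_real/normr_real.
apply: (le_trans (ler_normD (a *: S x) (T x))).
rewrite rmorphD rmorphM /= aE mulrDl normrZ -mulrA.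
by apply: lerD => //; apply: ler_wpM2l.
Qed.

HB.instance Definition _ :=
  GRing.isSubmodClosed.Build _ _ bounded_operator bounded_operator_submod.
HB.instance Definition _ := [SubChoice_isSubLmodule of bop by <:].

Lemma bop_linear (T : bop) : linear T.
Proof. by case/bounded_operatorP: (bop_funP T). Qed.

Lemma bounded_operator_id : idfun \in bounded_operator.
Proof.
by apply/bounded_operatorP; split=> //; exists 1 => x; rewrite mul1r.
Qed.

Lemma bounded_operator_comp (S T : bop) : S \o T \in bounded_operator.
Proof.
have [linS [M SM]] := elimT (bounded_operatorP _) (bop_funP S).
have [linT [N TN]] := elimT (bounded_operatorP _) (bop_funP T).
apply/bounded_operatorP; split; first by move=> a x y /=; rewrite linT linS.
exists (`|M| * N) => x /=; apply: (le_trans (SM _)).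
rewrite rmorphM /= -mulrA.
apply: (@le_trans _ _ (`|M|%:C * `|T x|)).
  by apply: ler_wpM2r => //; rewrite lecR ler_norm.
by apply: ler_wpM2l => //; rewrite lecR.
Qed.

Definition bop1 : bop := Bop bounded_operator_id.
Definition bopM (S T : bop) : bop := Bop (bounded_operator_comp S T).

Lemma bopMA : associative bopM.
Proof. by move=> S T U; apply: val_inj. Qed.

Lemma bop1M : left_id bop1 bopM.
Proof. by move=> T; apply: val_inj. Qed.

Lemma bopM1 : right_id bop1 bopM.
Proof. by move=> T; apply: val_inj. Qed.

Lemma bopMDl : left_distributive bopM +%R.
Proof. by move=> S T U; apply: val_inj. Qed.

Lemma bopMDr : right_distributive bopM +%R.
Proof.
move=> S T U; apply: val_inj; apply/funext => x /=.
by have := bop_linear S 1 (T x) (U x); rewrite !scale1r.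
Qed.

HB.instance Definition _ :=
  GRing.Zmodule_isPzRing.Build bop bopMA bop1M bopM1 bopMDl bopMDr.

Lemma bopE (S T : bop) x : (S * T) x = S (T x).
Proof. by []. Qed.

Definition idempotent_bop (P : bop) : Prop := P ^+ 2 = P.

Definition infinite_rank (A : bop) : Prop :=
  infinite_dimension (closure (range A)).

Definition infinite_corank (A : bop) : Prop :=
  infinite_dimension (orthogonal_complement (closure (range A))).

Definition idempotent_inf_rank_corank (P : bop) : Prop :=
  [/\ idempotent_bop P, infinite_rank P & infinite_corank P].

(* For a complete orthonormal sequence [e], the identities below have exactly
   one bounded solution [S] for every [T]; the default value [0] of [xget] is
   never used. *)
Definition bop_transpose (e : nat -> H) (T : bop) : bop :=
  xget 0 [set S : bop | forall i j, '[S (e i), e j] = '[T (e j), e i]].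

End BoundedOperators.

Arguments bop {R} H.

(* Main.v *)
(* An operator [P] is an idempotent of infinite rank and corank iff both [P]
   and [1 - P] are of the form [U V] with [V U = 1], a condition on the ring
   B(H) alone.  Call such a [P] big.  If [P] and [Q] are big and so is [P - Q],
   or so is [P + Q], then idempotency of the images determines
   [phi P phi Q + phi Q phi P], and likewise with [X] in place of [Q] if
   [P + X] and [P - X] are big, as for [X] off-diagonal with respect to [P].
   Big idempotents additively span B(H): their span contains the off-diagonal
   elements, hence, by conjugation, the corners of commutators, and every
   operator is a sum of commutators since the operators [diag (a, a, ...)]
   exist.  Used in the corners of [P], this makes [phi] a Jordan automorphism.

   Let [p] be the projection onto the line of [e 0] and [q = phi p].  The image
   of each [X] in [(1 - p) B(H) p] squares to zero, so it lies in
   [(1 - q) B(H) q] or in [q B(H) (1 - q)]; by linearity the same alternative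
   holds for all [X], and composing with the transpose we may assume the former.
   Then [phi (T X) = phi T phi X] whenever [X p = X], so for [x0 <> 0] in the
   range of [q], [A x = phi (<., e 0> x) x0] defines a linear bijection with
   [phi T A = A T] for all [T], and such intertwiners are bounded. *)

Require Import Defs.
From HB Require Import structures.
From mathcomp Require Import all_boot all_order all_algebra.
From mathcomp Require Import complex.
From mathcomp Require Import all_classical all_reals.
From mathcomp Require Import topology normedtype.

Set Implicit Arguments.
Unset Strict Implicit.
Unset Printing Implicit Defensive.

Import Order.TTheory GRing.Theory Num.Theory.
Import numFieldNormedType.Exports.

Local Open Scope classical_set_scope.
Local Open Scope ring_scope.

(** * Equalities in abelian groups *)

(** Syntax for proof by reflection: an expression is determined by its integer coefficients [zcoef],
    so an identity is decided by computation. *)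
Inductive zmod_expr :=
  ZVar of nat | ZZero | ZAdd of zmod_expr & zmod_expr | ZOpp of zmod_expr.

Section ZmodExpr.
Context (V : zmodType).

Fixpoint zeval (env : seq V) e : V :=
  match e with
  | ZVar i => nth 0 env i
  | ZZero => 0
  | ZAdd e1 e2 => zeval env e1 + zeval env e2
  | ZOpp e1 => - zeval env e1
  end.

Fixpoint zcoef e (i : nat) : int :=
  match e with
  | ZVar j => (i == j)%:Z
  | ZZero => 0
  | ZAdd e1 e2 => zcoef e1 i + zcoef e2 i
  | ZOpp e1 => - zcoef e1 i
  end.

Lemma zeval_coef env e :
  zeval env e = \sum_(i < size env) env`_i *~ zcoef e i.
Proof.
elim: e => [j||e1 IH1 e2 IH2|e1 IH1] /=.
- have [jlt|jge] := ltnP j (size env).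
    rewrite (bigD1 (Ordinal jlt)) //= eqxx big1 ?addr0 // => i.
    by rewrite -val_eqE /= => /negbTE->.
  rewrite nth_default // big1 // => i _.
  by rewrite ltn_eqF // (leq_trans (ltn_ord i)).
- by rewrite big1.
- by rewrite IH1 IH2 -big_split; apply: eq_bigr => i _; rewrite mulrzDr.
- by rewrite IH1 -sumrN; apply: eq_bigr => i _; rewrite mulrNz.
Qed.

Lemma zeval_eq env e1 e2 :
  all (fun i => zcoef e1 i == zcoef e2 i) (iota 0 (size env)) ->
  zeval env e1 = zeval env e2.
Proof.
move=> /allP h; rewrite !zeval_coef; apply: eq_bigr => i _; congr (_ *~ _).
by apply/eqP/h; rewrite mem_iota /=.
Qed.
End ZmodExpr.

(** The dummy [match goal] lets [unify] run while a term is being built; atoms are thus compared up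
    to unification. *)
Ltac zmod_cons x l :=
  match l with
  | nil => constr:(cons x nil)
  | cons ?y _ => let _ := match goal with _ => unify x y end in l
  | cons ?y ?k => let k' := zmod_cons x k in constr:(cons y k')
  end.

Ltac zmod_atoms t l :=
  lazymatch t with
  | (?a + ?b)%R => let l' := zmod_atoms a l in zmod_atoms b l'
  | (- ?a)%R => zmod_atoms a l
  | 0%R => l
  | _ => zmod_cons t l
  end.

Ltac zmod_index x l :=
  match l with
  | cons ?y _ => let _ := match goal with _ => unify x y end in constr:(0%N)
  | cons _ ?k => let n := zmod_index x k in constr:(S n)
  end.

Ltac zmod_reify t l :=
  lazymatch t with
  | (?a + ?b)%R =>
      let e1 := zmod_reify a l in
      let e2 := zmod_reify b l in constr:(ZAdd e1 e2)
  | (- ?a)%R => let e1 := zmod_reify a l in constr:(ZOpp e1)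
  | 0%R => constr:(ZZero)
  | _ => let n := zmod_index t l in constr:(ZVar n)
  end.

(* Decides equalities that hold in every abelian group. *)
Ltac zmod :=
  rewrite ?mulr2n;
  lazymatch goal with
  | |- @eq ?V ?a ?b =>
      let l := zmod_atoms a (@nil V) in
      let l := zmod_atoms b l in
      let e1 := zmod_reify a l in
      let e2 := zmod_reify b l in
      exact (@zeval_eq _ l e1 e2 isT)
  end.

(** * Rings with a Cuntz pair *)

(** Reduces deducing one equation from another to an identity that [zmod] decides. *)
Lemma eq_of_subr (V : zmodType) (a b x y : V) :
  a = b -> x - y = a - b -> x = y.
Proof. by move=> -> /eqP; rewrite subrr subr_eq0 => /eqP. Qed.

Section RingIdempotents.
Context (A : pzRingType).
Implicit Types (a b p q u v x y : A) (K : A -> Prop).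

Lemma idem_addP p q : p * p = p -> q * q = q ->
  (p + q) * (p + q) = p + q -> p * q + q * p = 0.
Proof.
move=> pp qq h; apply: (eq_of_subr h).
by rewrite mulrDl !mulrDr pp qq; zmod.
Qed.

Lemma idem_subP p q : p * p = p -> q * q = q ->
  (p - q) * (p - q) = p - q -> p * q + q * p = q + q.
Proof.
move=> pp qq h; apply: (eq_of_subr (esym h)).
by rewrite mulrBl !mulrBr pp qq; zmod.
Qed.

(** Subtracting the two hypotheses leaves [2 (p x + x p) = 2 x]. *)
Lemma idem_tangentP p x : (forall a, a + a = 0 -> a = 0) ->
  (p + x) * (p + x) = p + x -> (p - x) * (p - x) = p - x -> p * x + x * p = x.
Proof.
move=> tf hD hB; apply/eqP; rewrite -subr_eq0; apply/eqP/tf.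
have h : (p + x) * (p + x) - (p - x) * (p - x) = (p + x) - (p - x).
  by rewrite hD hB.
apply: (eq_of_subr h).
by rewrite !mulrDl !mulrDr !mulNr !mulrN; zmod.
Qed.

(** Algebraic Murray-von Neumann equivalence of [p] with 1. In B(H) it will single out the
    idempotents of infinite rank. *)
Definition equiv1 p := exists u v, v * u = 1 /\ u * v = p.

Definition biequiv1 p := equiv1 p /\ equiv1 (1 - p).

Lemma equiv1_idem p : equiv1 p -> p * p = p.
Proof. by move=> [u [v [vu <-]]]; rewrite mulrA -(mulrA u) vu mulr1. Qed.

Lemma equiv1_conj u v p : v * u = 1 -> equiv1 p -> equiv1 (u * p * v).
Proof.
move=> vu [x [y [yx <-]]]; exists (u * x), (y * v); split; last by rewrite !mulrA.
by rewrite mulrA -(mulrA y) vu mulr1.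
Qed.

Lemma biequiv1C p : biequiv1 p -> biequiv1 (1 - p).
Proof. by case=> h1 h2; split=> //; rewrite subKr. Qed.

Lemma biequiv1_idem p : biequiv1 p -> p * p = p.
Proof. by case=> /equiv1_idem. Qed.

Lemma biequiv1_conj u v p :
  v * u = 1 -> u * v = 1 -> biequiv1 p -> biequiv1 (u * p * v).
Proof.
move=> vu uv [h1 h2]; split; first exact: equiv1_conj.
have -> : 1 - u * p * v = u * (1 - p) * v by rewrite mulrBr mulrBl mulr1 uv.
exact: equiv1_conj.
Qed.

(** Since [x * x = 0], [1 - x] is invertible with inverse [1 + x], and it conjugates [p] to
    [p + x]. *)
Lemma biequiv1_add_off p x : biequiv1 p -> p * x = x -> x * p = 0 ->
  biequiv1 (p + x).
Proof.
move=> hp px xp.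
have xx : x * x = 0 by rewrite -[X in _ * X]px mulrA xp mul0r.
have -> : p + x = (1 - x) * p * (1 + x).
  by rewrite mulrBl mul1r xp subr0 mulrDr mulr1 px.
by apply: biequiv1_conj => //; rewrite ?(mulrDl, mulrDr)
  !(mulNr, mulrN, mulr1, mul1r) xx; zmod.
Qed.

(** [K] stands for an additive subgroup containing the big idempotents, among them [p + x] and
    [p]. *)
Lemma off_biequiv1 K p x : (forall x y, K x -> K y -> K (x - y)) ->
  (forall q, biequiv1 q -> K q) -> biequiv1 p -> p * x = x -> x * p = 0 -> K x.
Proof.
move=> KB Ki hp px xp; have -> : x = p + x - p by zmod.
by apply: KB; apply: Ki => //; exact: biequiv1_add_off.
Qed.

End RingIdempotents.

(** The Cuntz relations, with [t1] and [t2] in place of the adjoints. They identify [A] with the 2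
    by 2 matrices over [A]: the matrix unit (i, j) with entry [a] is [si * a * tj]. *)
Record cuntz_pair (A : pzRingType) (s1 s2 t1 t2 : A) : Prop := CuntzPair {
  cuntz11 : t1 * s1 = 1;
  cuntz22 : t2 * s2 = 1;
  cuntz12 : t1 * s2 = 0;
  cuntz21 : t2 * s1 = 0;
  cuntzD : s1 * t1 + s2 * t2 = 1
}.

Section CuntzRing.
Context (A : pzRingType) (s1 s2 t1 t2 : A) (st : cuntz_pair s1 s2 t1 t2).
Implicit Types (a b d p q u v x y z w : A) (K : A -> Prop).

(** The unit is the orthogonal sum of [s1 * t1] and [s2 * t2], both equivalent to 1; the first is
    carried to [p], the second to [q]. *)
Lemma equiv1_add p q :
  equiv1 p -> equiv1 q -> p * q = 0 -> q * p = 0 -> equiv1 (p + q).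
Proof.
move=> [x [y [yx xy]]] [z [w [wz zw]]] pq qp.
have yz : y * z = 0.
  have -> : y * z = y * (p * q) * z.
    by rewrite -xy -zw !mulrA yx mul1r -!mulrA wz mulr1.
  by rewrite pq mulr0 mul0r.
have wx : w * x = 0.
  have -> : w * x = w * (q * p) * x.
    by rewrite -xy -zw !mulrA wz mul1r -!mulrA yx mulr1.
  by rewrite qp mulr0 mul0r.
case: st => t1s1 t2s2 t1s2 t2s1 stD.
exists (x * t1 + z * t2), (s1 * y + s2 * w); split; last first.
  by rewrite mulrDl !mulrDr -!mulrA !(mulrA t1) !(mulrA t2) t1s1 t2s2 t1s2 t2s1
    !mul1r !mul0r !mulr0 addr0 add0r xy zw.
by rewrite mulrDl !mulrDr -!mulrA !(mulrA y) !(mulrA w) yx wz yz wx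
    !mul1r !mul0r !mulr0 addr0 add0r.
Qed.

Lemma biequiv1_cuntz : biequiv1 (s1 * t1).
Proof.
case: st => t1s1 t2s2 t1s2 t2s1 stD; split; first by exists s1, t1.
by exists s2, t2; split=> //; rewrite -stD addrC addKr.
Qed.

(** The map [a |-> u * a * v] identifies the ring with the corner of [p]. The complement of
    [u * q * v] is the orthogonal sum of [1 - p] and [u * (1 - q) * v]. *)
Lemma biequiv1_corner u v p q : equiv1 (1 - p) -> v * u = 1 -> u * v = p ->
  biequiv1 q -> biequiv1 (u * q * v).
Proof.
move=> hp vu uv [q1 q2]; split; first exact: equiv1_conj.
have -> : 1 - u * q * v = (1 - p) + u * (1 - q) * v.
  by rewrite mulrBr mulrBl mulr1 uv; zmod.
have pu : p * u = u by rewrite -uv -mulrA vu mulr1.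
have vp : v * p = v by rewrite -uv mulrA vu mul1r.
apply: equiv1_add => //; first exact: equiv1_conj.
  by rewrite -mulrA mulrA mulrBl pu mul1r subrr mul0r.
by rewrite -mulrA (mulrBr v) vp mulr1 subrr mulr0.
Qed.

(* The hypothesis [hD] says that [diag (a, a, ...)] exists: [d] is the direct
   sum of [a] and [d] itself, which makes [s1 * a * t1] a commutator. *)
Lemma biequiv1_span K : (forall a, exists d, d = s1 * a * t1 + s2 * d * t2) ->
  (forall x y, K x -> K y -> K (x - y)) ->
  (forall q, biequiv1 q -> K q) -> forall a, K a.
Proof.
move=> hD KB Ki; case: (st) => t1s1 t2s2 t1s2 t2s1 stD.
have K0 : K 0 by rewrite -(subrr (s1 * t1)); apply: KB; apply: Ki biequiv1_cuntz.
have KN x : K x -> K (- x) by move=> Kx; rewrite -sub0r; exact: KB.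
have KD x y : K x -> K y -> K (x + y).
  by move=> Kx Ky; rewrite -[y]opprK; apply: KB => //; exact: KN.
have s1t1 := biequiv1_cuntz.
have s2t2 : 1 - s1 * t1 = s2 * t2 by rewrite -stD addrC addKr.
have K21 a : K (s2 * a * t1).
  apply: (off_biequiv1 KB Ki (biequiv1C s1t1)); rewrite s2t2.
    by rewrite !mulrA -(mulrA s2) t2s2 mulr1.
  by rewrite !mulrA -(mulrA _ t1) t1s2 mulr0 mul0r.
(* Stated for every subgroup, because it is also applied to a conjugate of [K]. *)
have offK K' : (forall x y, K' x -> K' y -> K' (x - y)) ->
    (forall q, biequiv1 q -> K' q) -> forall a, K' (s1 * a * t2).
  move=> KB' Ki' a; apply: (off_biequiv1 KB' Ki' s1t1).
    by rewrite !mulrA -(mulrA s1) t1s1 mulr1.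
  by rewrite !mulrA -(mulrA _ t2) t2s1 mulr0 mul0r.
have K12 := offK K KB Ki.
(* With [y * y = 0], conjugating the off-diagonal [x] by [1 + y] gives [x + y x - x y - y x y],
   where [x] and [y x y] are off-diagonal and [y x - x y] is the element sought. *)
have Kdiag a b : K (s2 * (b * a) * t2 - s1 * (a * b) * t1).
  pose y := s2 * b * t1.
  have yy : y * y = 0.
    by rewrite /y !mulrA -(mulrA _ t1) t1s2 mulr0 !mul0r.
  pose x := s1 * a * t2.
  have Kx : K ((1 + y) * x * (1 - y)).
    apply: (offK (fun x => K ((1 + y) * x * (1 - y)))) => [z w Kz Kw|q hq].
      by rewrite mulrBr mulrBl; exact: KB.
    by apply/Ki/biequiv1_conj => //; rewrite ?(mulrDl, mulrDr)
      !(mulNr, mulrN, mulr1, mul1r) yy; zmod.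
  have yx : y * x = s2 * (b * a) * t2.
    by rewrite /y /x !mulrA -(mulrA _ t1) t1s1 mulr1.
  have xy : x * y = s1 * (a * b) * t1.
    by rewrite /y /x !mulrA -(mulrA _ t2) t2s2 mulr1.
  have yxy : y * x * y = s2 * (b * a * b) * t1.
    by rewrite -mulrA xy /y !mulrA -(mulrA _ t1) t1s1 mulr1.
  have -> : s2 * (b * a) * t2 - s1 * (a * b) * t1 =
      (1 + y) * x * (1 - y) - x + y * x * y.
    by rewrite -yx -xy !(mulrDl, mulrDr) !(mulrN, mulr1, mul1r); zmod.
  by apply: KD; [apply: KB => //; exact: K12|rewrite yxy].
(* Two instances of [Kdiag] with the same entry at (2, 2) are subtracted. *)
have Kcomm a b : K (s1 * (a * b - b * a) * t1).
  have -> : s1 * (a * b - b * a) * t1 =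
      (s2 * (1 * (b * a)) * t2 - s1 * ((b * a) * 1) * t1) -
      (s2 * (b * a) * t2 - s1 * (a * b) * t1).
    by rewrite mul1r mulr1 mulrBr mulrBl; zmod.
  exact: KB.
have K11 a : K (s1 * a * t1).
  have [d dE] := hD a.
  (* The first commutator is [d - s2 * d * t2 = s1 * a * t1], the second is [s1 * a * t1 - a]. *)
  have -> : a = (t2 * (s2 * d) - (s2 * d) * t2) - ((s1 * a) * t1 - t1 * (s1 * a)).
    by rewrite !mulrA t2s2 t1s1 !mul1r {1}dE; zmod.
  by rewrite mulrBr mulrBl; apply: KB.
have K22 a : K (s2 * a * t2).
  have := Kdiag a 1; rewrite mul1r mulr1 => h.
  by rewrite -(subrK (s1 * a * t1) (s2 * a * t2)); apply: KD.
move=> a; have -> : a = s1 * (t1 * a * s1) * t1 + s1 * (t1 * a * s2) * t2 +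
    (s2 * (t2 * a * s1) * t1 + s2 * (t2 * a * s2) * t2).
  have sandwich x y z w : x * (y * a * z) * w = (x * y) * a * (z * w).
    by rewrite !mulrA.
  by rewrite !sandwich -!mulrDr stD !mulr1 -mulrDl stD mul1r.
by apply: (KD); apply: KD.
Qed.

(** * Additive maps preserving big idempotents are Jordan maps *)

Section Jordan.
Context (phi : {additive A -> A}).
Hypothesis diagP : forall a, exists d, d = s1 * a * t1 + s2 * d * t2.
Hypothesis tf : forall a, a + a = 0 -> a = 0.
Hypothesis phi_bi : forall p, biequiv1 p -> biequiv1 (phi p).

Lemma jordan_off p x : biequiv1 p -> biequiv1 (p + x) -> biequiv1 (p - x) ->
  phi p * phi x + phi x * phi p = phi x.
Proof.
move=> /phi_bi/biequiv1_idem hp /phi_bi/biequiv1_idem hD /phi_bi/biequiv1_idem hB.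
by apply: idem_tangentP => //; rewrite -?raddfD -?raddfB.
Qed.

(** The identity is additive in [a], so [a] may be taken to be a big idempotent [q]. Then [p],
    [u * q * v] and their difference [u * (1 - q) * v] are big. *)
Lemma jordan_corner p u v a : biequiv1 p -> v * u = 1 -> u * v = p ->
  phi p * phi (u * a * v) + phi (u * a * v) * phi p =
  phi (u * a * v) + phi (u * a * v).
Proof.
move=> hp vu uv; case: (hp) => _ hp2.
move: a; apply: (biequiv1_span diagP) => [a b Ka Kb|q hq].
  rewrite mulrBr mulrBl !raddfB /= mulrBl mulrBr.
  by apply: (eq_of_subr (congr2 (fun a b => a - b) Ka Kb)); zmod.
have pq : p - u * q * v = u * (1 - q) * v by rewrite mulrBr mulrBl mulr1 uv.
apply: idem_subP; [exact/biequiv1_idem/phi_bi| |].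
  exact/biequiv1_idem/phi_bi/(biequiv1_corner hp2).
rewrite -raddfB pq; apply/biequiv1_idem/phi_bi/(biequiv1_corner hp2) => //.
exact: biequiv1C.
Qed.

(** For a big idempotent [q] in place of [a], the sum [p + u * q * v] is big as the complement of
    [u * (1 - q) * v]. *)
Lemma jordan_cocorner p u v a : biequiv1 p -> v * u = 1 -> u * v = 1 - p ->
  phi p * phi (u * a * v) + phi (u * a * v) * phi p = 0.
Proof.
move=> hp vu uv; case: (hp) => hp1 _.
have hp2 : equiv1 (1 - (1 - p)) by rewrite subKr.
move: a; apply: (biequiv1_span diagP) => [a b Ka Kb|q hq].
  rewrite mulrBr mulrBl !raddfB /= mulrBl mulrBr.
  by apply: (eq_of_subr (congr2 (fun a b => a - b) Ka Kb)); zmod.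
have pq : p + u * q * v = 1 - u * (1 - q) * v.
  by rewrite mulrBr mulrBl mulr1 uv; zmod.
apply: idem_addP; [exact/biequiv1_idem/phi_bi| |].
  exact/biequiv1_idem/phi_bi/(biequiv1_corner hp2).
rewrite -raddfD pq; apply/biequiv1_idem/phi_bi/biequiv1C/(biequiv1_corner hp2) => //.
exact: biequiv1C.
Qed.

(** The four Peirce components of [a] with respect to [p] and [r = 1 - p] are treated separately. *)
Lemma jordan_biequiv1 p a : biequiv1 p ->
  phi (p * a + a * p) = phi p * phi a + phi a * phi p.
Proof.
move=> hp; have pp := biequiv1_idem hp.
set r := 1 - p; have hr : biequiv1 r by exact: biequiv1C.
have pr : p * r = 0 by rewrite mulrBr pp mulr1 subrr.
have rp : r * p = 0 by rewrite mulrBl pp mul1r subrr.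
have rr := biequiv1_idem hr.
have prD : p + r = 1 by rewrite addrC subrK.
have hpr : phi p * phi (p * a * r) + phi (p * a * r) * phi p = phi (p * a * r).
  have off b : p * (p * b * r) = p * b * r /\ p * b * r * p = 0.
    by rewrite !mulrA pp -[_ * r * p]mulrA rp mulr0.
  apply: jordan_off => //.
    by have [? ?] := off a; exact: biequiv1_add_off.
  have -> : - (p * a * r) = p * (- a) * r by rewrite mulrN mulNr.
  by have [? ?] := off (- a); exact: biequiv1_add_off.
have hrp : phi p * phi (r * a * p) + phi (r * a * p) * phi p = phi (r * a * p).
  have off b : r * (r * b * p) = r * b * p /\ r * b * p * r = 0.
    by rewrite !mulrA rr -[_ * p * r]mulrA pr mulr0.
  apply: jordan_off => //.
    (* [biequiv1_add_off] applies to [r], not to [p], hence the passage to complements. *)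
    have -> : p + r * a * p = 1 - (r + r * (- a) * p).
      by rewrite mulrN mulNr /r; zmod.
    by have [? ?] := off (- a); exact/biequiv1C/biequiv1_add_off.
  have -> : p - r * a * p = 1 - (r + r * a * p) by rewrite /r; zmod.
  by have [? ?] := off a; exact/biequiv1C/biequiv1_add_off.
have hpp : phi p * phi (p * a * p) + phi (p * a * p) * phi p =
    phi (p * a * p) + phi (p * a * p).
  case: (hp) => -[u [v [vu uv]]] _.
  have -> : p * a * p = u * (v * a * u) * v by rewrite -uv !mulrA.
  exact: jordan_corner.
have hrr : phi p * phi (r * a * r) + phi (r * a * r) * phi p = 0.
  case: (hr) => -[u [v [vu uv]]] _.
  have -> : r * a * r = u * (v * a * u) * v by rewrite -uv !mulrA.
  exact: jordan_cocorner.
clearbody r.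
have aE : a = p * a * p + p * a * r + (r * a * p + r * a * r).
  by rewrite -!mulrDr prD !mulr1 -mulrDl prD mul1r.
have -> : p * a + a * p = p * a * p + p * a * p + (p * a * r + r * a * p).
  by rewrite -{1}[a]mulr1 -{2}[a]mul1r -prD !mulrDr !mulrDl !mulrA; zmod.
have -> : phi a = phi (p * a * p) + phi (p * a * r) +
    (phi (r * a * p) + phi (r * a * r)) by rewrite {1}aE !raddfD.
rewrite !raddfD !mulrDr !mulrDl /=.

(* On the left, each Peirce term, with 0 for the one in [r A r], is replaced by an anticommutator
   with [phi p]. *)
rewrite -[LHS]addr0 -{1}hpr -{1}hrp -hpp -hrr.
by zmod.
Qed.

Theorem jordan_of_biequiv1 a b :
  phi (a * b + b * a) = phi a * phi b + phi b * phi a.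
Proof.
move: a; apply: (biequiv1_span diagP) => [x y Kx Ky|q hq].
  apply: (eq_of_subr (congr2 (fun a b => a - b) Kx Ky)).
  by rewrite !(mulrDl, mulrDr, mulrN, mulNr, raddfD, raddfN) /=; zmod.
exact: jordan_biequiv1.
Qed.

End Jordan.
End CuntzRing.

(** * Jordan maps and a minimal idempotent *)

Section JordanMap.
Context (A : pzRingType) (phi : {additive A -> A}).
Implicit Types (a b x y z t : A).
Hypothesis phi_inj : injective phi.
Hypothesis phi_surj : forall b, exists a, phi a = b.
Hypothesis phiJ : forall a b, phi (a * b + b * a) = phi a * phi b + phi b * phi a.
Hypothesis tf : forall a, a + a = 0 -> a = 0.

Lemma torsion_free_eq a b : a + a = b + b -> a = b.
Proof.
move=> ab; apply/eqP; rewrite -subr_eq0; apply/eqP/tf.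
by apply: (eq_of_subr ab); zmod.
Qed.

Lemma jordan1 : phi 1 = 1.
Proof.
(* As [phi b = 1], the Jordan identity for 1 and [b] reads [2 = 2 phi 1]. *)
have [b b1] := phi_surj 1; have := phiJ 1 b.
by rewrite mul1r mulr1 raddfD b1 mulr1 mul1r => /torsion_free_eq.
Qed.

Lemma jordan_sqr a : phi (a * a) = phi a * phi a.
Proof. by apply: torsion_free_eq; rewrite -raddfD phiJ. Qed.

Context (p : A) (pp : p * p = p).
Local Notation q := (phi p).

Let qq : q * q = q.
Proof. by rewrite -jordan_sqr pp. Qed.

(** With [p o a = p a + a p], one has [2 p a p = p o (p o a) - p o a], an expression that [phi]
    respects. *)
Lemma jordan_compression a : phi (p * a * p) = q * phi a * q.
Proof.
apply: torsion_free_eq.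
have -> : phi (p * a * p) + phi (p * a * p) =
    phi (p * (p * a + a * p) + (p * a + a * p) * p) - phi (p * a + a * p).
  rewrite -raddfD -raddfB; congr (phi _).
  by rewrite !(mulrDl, mulrDr) -!mulrA pp !mulrA pp; zmod.
by rewrite !phiJ !(mulrDl, mulrDr) -!mulrA qq !mulrA qq; zmod.
Qed.

Lemma jordan_sqr0 x : p * x + x * p = x -> x * x = 0 -> phi x * q * phi x = 0.
Proof.
move=> px xx; have : q * phi x + phi x * q = phi x by rewrite -phiJ px.
move=> /(canRL (addrK _)) qx.
by rewrite -mulrA qx mulrBr mulrA -jordan_sqr xx raddf0 mul0r subr0.
Qed.

Hypothesis prime_ring : forall a b, (forall t, a * t * b = 0) -> a = 0 \/ b = 0.
(** Minimality of [q] phrased without scalars; it holds when each [q * t * q] is a multiple of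
    [q]. *)
Hypothesis q_minimal : forall a b t, a * q * b = 0 -> a * (q * t * q) * b = 0.
Hypothesis p_neq0 : p != 0.
Hypothesis p_neq1 : p != 1.

Let q_neq0 : q <> 0.
Proof. by rewrite -(raddf0 phi) => /phi_inj/eqP; rewrite (negbTE p_neq0). Qed.

Let q_neq1 : 1 - q <> 0.
Proof.
move=> /eqP; rewrite subr_eq0 -jordan1 => /eqP/phi_inj/esym/eqP.
by rewrite (negbTE p_neq1).
Qed.

(** The Peirce components [(1 - p) A p] and, for [row], [p A (1 - p)]. *)
Local Notation column x := (p * x = 0 /\ x * p = x).
Local Notation row y := (p * y = y /\ y * p = 0).

(** From [phi x * q * phi x = 0], minimality gives [(phi x * q) * t * (q * phi x) = 0] for all [t],
    and primeness makes one factor vanish. *)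
Let off_dichotomy x : p * x + x * p = x -> x * x = 0 ->
  q * phi x = 0 \/ phi x * q = 0.
Proof.
move=> px xx; have xqx := jordan_sqr0 px xx.
have [t|?|?] := prime_ring (a := phi x * q) (b := q * phi x); [|by right|by left].
by have := q_minimal t xqx; rewrite !mulrA.
Qed.

(** The argument that a group is not the union of two proper subgroups: if [q * phi x] is nonzero,
    the alternative for [x + y] settles the one for [y]. *)
Let dichotomy (P : A -> Prop) :
  (forall x y, P x -> P y -> P (x + y)) ->
  (forall x, P x -> q * phi x = 0 \/ phi x * q = 0) ->
  (forall x, P x -> q * phi x = 0) \/ (forall x, P x -> phi x * q = 0).
Proof.
move=> PD Pq; have [?|/existsNP[x /not_implyP[Px qx]]] :=
  EM (forall x, P x -> q * phi x = 0); first by left.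
have xq : phi x * q = 0 by case: (Pq _ Px).
right=> y Py; case: (Pq _ Py) => // qy.
case: (Pq _ (PD _ _ Px Py)); rewrite raddfD ?mulrDl ?mulrDr.
  by rewrite qy addr0.
by rewrite xq add0r.
Qed.

Let column_dichotomy :
  (forall x, column x -> q * phi x = 0) \/ (forall x, column x -> phi x * q = 0).
Proof.
apply: dichotomy => [x y [px xp] [py yp]|x [px xp]].
  by split; rewrite ?mulrDl ?mulrDr ?px ?py ?xp ?yp ?addr0.
apply: off_dichotomy; first by rewrite px xp add0r.
by rewrite -{1}xp -mulrA px mulr0.
Qed.

Let row_dichotomy :
  (forall x, row x -> q * phi x = 0) \/ (forall x, row x -> phi x * q = 0).
Proof.
apply: dichotomy => [x y [px xp] [py yp]|x [px xp]].
  by split; rewrite ?mulrDl ?mulrDr ?px ?py ?xp ?yp ?addr0.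
apply: off_dichotomy; first by rewrite px xp addr0.
by rewrite -{2}px mulrA xp mul0r.
Qed.

(** The preimage [z] satisfies [p z + z p = z], so [p z p = 0], and [z p] and [p z] are its column
    and row. *)
Let off_preimage z' : q * z' + z' * q = z' ->
  exists x y, [/\ column x, row y & z' = phi x + phi y].
Proof.
have [z <-] := phi_surj z'; rewrite -phiJ => /phi_inj pz.
have pzp : p * z * p = 0.
  have := congr1 (fun a => a * p) pz.
  rewrite mulrDl -(mulrA z) pp => /eqP.
  by rewrite -subr_eq0 addrK => /eqP.
exists (z * p), (p * z); split; last by rewrite -raddfD addrC pz.
  by split; rewrite ?mulrA// -mulrA pp.
by split; rewrite ?mulrA ?pp.
Qed.

Theorem jordan_dichotomy :
  ((forall x, column x -> q * phi x = 0) /\ (forall y, row y -> phi y * q = 0)) \/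
  ((forall x, column x -> phi x * q = 0) /\ (forall y, row y -> q * phi y = 0)).
Proof.
have qr : q * (1 - q) = 0 by rewrite mulrBr mulr1 qq subrr.
have rq : (1 - q) * q = 0 by rewrite mulrBl mul1r qq subrr.
(* If [q] kills the images of columns and of rows from the same side, then by [off_preimage] either
   [q A (1 - q)] or [(1 - q) A q] is 0, against primeness. *)
case: column_dichotomy => hc; case: row_dichotomy => hr;
  [exfalso|by left|by right|exfalso].
  have [t|/q_neq0//|/q_neq1//] := prime_ring (a := q) (b := 1 - q).
  set z := q * t * (1 - q).
  have qz : q * z = z by rewrite /z !mulrA qq.
  have zq : z * q = 0 by rewrite /z -mulrA rq mulr0.
  have [|x [y [cx ry zE]]] := off_preimage (z' := z); first by rewrite qz zq addr0.
  by rewrite -qz zE mulrDr hc// hr// addr0.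
have [t|/q_neq1//|/q_neq0//] := prime_ring (a := 1 - q) (b := q).
set z := (1 - q) * t * q.
have qz : q * z = 0 by rewrite /z !mulrA qr !mul0r.
have zq : z * q = z by rewrite /z -mulrA qq.
have [|x [y [cx ry zE]]] := off_preimage (z' := z); first by rewrite qz zq add0r.
by rewrite -zq zE mulrDl hc// hr// addr0.
Qed.

Hypothesis phi_column : forall x, column x -> q * phi x = 0.
Hypothesis phi_row : forall y, row y -> phi y * q = 0.

(** Among the images of the Peirce components of [a], right multiplication by [q] fixes those of
    [p a p] and of the column and kills the other two. *)
Lemma jordan_mulr_idem a : phi (a * p) = phi a * q.
Proof.
set r := 1 - p.
have pr : p * r = 0 by rewrite mulrBr mulr1 pp subrr.
have rp : r * p = 0 by rewrite mulrBl mul1r pp subrr.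
have prD : p + r = 1 by rewrite addrC subrK.
have cx : column (r * a * p).
  by split; [rewrite !mulrA pr !mul0r|rewrite -(mulrA (r * a)) pp].
have ry : row (p * a * r).
  by split; [rewrite !mulrA pp|rewrite -(mulrA (p * a)) rp mulr0].
have xq : phi (r * a * p) * q = phi (r * a * p).
  by have := phiJ p (r * a * p); rewrite cx.1 cx.2 add0r (phi_column cx) add0r.
have wq : phi (r * a * r) * q = 0.
  set w := phi (r * a * r).
  have qw : q * w + w * q = 0.
    by rewrite -phiJ !mulrA pr !mul0r -(mulrA (r * a)) rp mulr0 addr0 raddf0.
  (* The combination on the right expands to [2 w q]. *)
  apply: tf; apply: (eq_of_subr (a := (q * w + w * q) * q - q * (q * w + w * q)
      + (q * w + w * q)) (b := 0)); first by rewrite qw mul0r mulr0 subr0 addr0.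
  by rewrite mulrDl mulrDr -!mulrA qq !mulrA qq; zmod.
have -> : a * p = p * a * p + r * a * p by rewrite -!mulrA -mulrDl prD mul1r.
have {3}-> : a = p * a * p + p * a * r + (r * a * p + r * a * r).
  by rewrite -!mulrDr prD !mulr1 -mulrDl prD mul1r.
clearbody r; rewrite !raddfD !mulrDl /= wq (phi_row ry) xq !addr0 jordan_compression.
by rewrite -[_ * q * q]mulrA qq.
Qed.

Hypothesis p_minimal : forall x t, x * p = x ->
  phi (x * (p * t * p)) = phi x * phi (p * t * p).

(** The Jordan identity for [t] and [x] is multiplied by [q] on the right. The contributions of
    [x t] cancel, because [x t p = x (p t p)] and [p_minimal] applies. *)
Theorem jordan_mul_column t x : x * p = x -> phi (t * x) = phi t * phi x.
Proof.
move=> xp; have xq : phi x * q = phi x by rewrite -jordan_mulr_idem xp.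
have e1 : phi ((t * x + x * t) * p) = phi (t * x) + phi x * (q * phi t * q).
  rewrite mulrDl -(mulrA t) xp raddfD -jordan_compression -p_minimal//.
  by rewrite !mulrA xp.
have e2 : phi (t * x + x * t) * q = phi t * phi x + phi x * (q * phi t * q).
  by rewrite phiJ mulrDl -(mulrA (phi t)) xq !mulrA xq.
by apply: (addIr (phi x * (q * phi t * q))); rewrite -e1 -e2 jordan_mulr_idem.
Qed.

End JordanMap.

(** * Hilbert space *)

Section InnerProduct.
Context (R : realType) (H : hilbertType R).
Implicit Types (x y z : H) (a : R[i]).

Lemma innerC x y : '[x, y] = '[y, x]^*.
Proof. by rewrite (hermC (inner (s:=H)) x y) mul1r. Qed.

Lemma innerDl x y z : '[x + y, z] = '[x, z] + '[y, z].
Proof. exact: linearDl. Qed.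

Lemma innerDr x y z : '[z, x + y] = '[z, x] + '[z, y].
Proof. exact: linearDr. Qed.

Lemma innerZl a x y : '[a *: x, y] = a * '[x, y].
Proof. exact: linearZl_LR. Qed.

Lemma innerZr a x y : '[x, a *: y] = a^* * '[x, y].
Proof. exact: linearZr_LR. Qed.

Lemma inner0l x : '[0, x] = 0.
Proof. exact: linear0l. Qed.

Lemma inner0r x : '[x, 0] = 0.
Proof. exact: linear0r. Qed.

Lemma innerNl x y : '[- x, y] = - '[x, y].
Proof. exact: linearNl. Qed.

Lemma innerNr x y : '[x, - y] = - '[x, y].
Proof. exact: linearNr. Qed.

Lemma inner_suml (I : Type) (r : seq I) (P : pred I) (F : I -> H) y :
  '[\sum_(i <- r | P i) F i, y] = \sum_(i <- r | P i) '[F i, y].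
Proof. exact: linear_sumlz. Qed.

Lemma inner_sumr (I : Type) (r : seq I) (P : pred I) (F : I -> H) y :
  '[y, \sum_(i <- r | P i) F i] = \sum_(i <- r | P i) '[y, F i].
Proof. exact: linear_sumr. Qed.

Lemma inner_eq0C x y : '[x, y] = 0 -> '[y, x] = 0.
Proof. by rewrite innerC => /(congr1 Num.conj); rewrite conjCK conjC0. Qed.

Lemma inner_extl x y : (forall z, '[x, z] = '[y, z]) -> x = y.
Proof.
move=> h; apply/eqP; rewrite -subr_eq0 -normr_eq0 -sqrf_eq0 -inner_normE.
by rewrite innerDl innerNl h subrr.
Qed.

Lemma normD_orth x y : '[x, y] = 0 -> `|x + y| ^+ 2 = `|x| ^+ 2 + `|y| ^+ 2.
Proof.
move=> xy; rewrite -!inner_normE innerDl !innerDr xy (inner_eq0C xy).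
by rewrite addr0 add0r.
Qed.

Lemma cauchy_schwarz x y : `|'[x, y]| <= `|x| * `|y|.
Proof.
have [->|y0] := eqVneq y 0; first by rewrite inner0r !normr0 mulr0.
have ny : `|y| != 0 by rewrite normr_eq0.
(* [a *: y] is the orthogonal projection of [x] onto the line of [y]. *)
pose a := '[x, y] / `|y| ^+ 2.
have ay : '[x - a *: y, a *: y] = 0.
  rewrite innerZr innerDl innerNl innerZl inner_normE /a divfK ?sqrf_eq0//.
  by rewrite subrr mulr0.
have := normD_orth ay; rewrite subrK => xE.
have aE : `|a *: y| = `|'[x, y]| / `|y|.
  rewrite normrZ /a normrM normfV normrX normr_id expr2 invfM mulrA.
  by rewrite divfK.
rewrite -ler_pdivrMr ?normr_gt0// -aE.
by rewrite -(@ler_pXn2r _ 2) ?nnegrE// xE lerDr exprn_ge0.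
Qed.

(** * Orthonormal sequences: Bessel's inequality and the Riesz-Fischer theorem *)

Definition orthonormal_seq (f : nat -> H) := forall i j, '[f i, f j] = (i == j)%:R.

Section Bessel.
Context (f : nat -> H) (f_on : orthonormal_seq f).
Implicit Types (c : nat -> R[i]) (s : seq nat).

Lemma inner_sum_orthonormal c s i : uniq s ->
  '[\sum_(j <- s) c j *: f j, f i] = if i \in s then c i else 0.
Proof.
move=> us; rewrite inner_suml; case: ifPn => [si|si].
  rewrite (bigD1_seq i) //= innerZl f_on eqxx mulr1 big1 ?addr0// => j ji.
  by rewrite innerZl f_on (negbTE ji) mulr0.
rewrite big_seq big1// => j js; rewrite innerZl f_on.
by case: eqVneq => [ji|]; rewrite ?mulr0//; rewrite -ji js in si.
Qed.

Lemma norm_sum_orthonormal c s : uniq s ->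
  `|\sum_(j <- s) c j *: f j| ^+ 2 = \sum_(j <- s) `|c j| ^+ 2.
Proof.
move=> us; rewrite -inner_normE {1}inner_sumr.
rewrite big_seq [RHS]big_seq; apply: eq_bigr => i si.
by rewrite innerZr inner_sum_orthonormal// si mulrC normCK.
Qed.

Lemma orth_residual x s i : uniq s -> i \in s ->
  '[x - \sum_(j <- s) '[x, f j] *: f j, f i] = 0.
Proof.
by move=> us si; rewrite innerDl innerNl inner_sum_orthonormal// si subrr.
Qed.

Lemma bessel x s : uniq s -> \sum_(j <- s) `|'[x, f j]| ^+ 2 <= `|x| ^+ 2.
Proof.
move=> us; set u := \sum_(j <- s) '[x, f j] *: f j.
have xu : '[x - u, u] = 0.
  rewrite {2}/u inner_sumr big_seq big1// => i si.
  by rewrite innerZr orth_residual// mulr0.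
rewrite -norm_sum_orthonormal// -[in leRHS](subrK u x) normD_orth//.
by rewrite lerDr exprn_ge0.
Qed.

(** The partial sums [s] are Cauchy: their squared norms [r] are nondecreasing and bounded, and
    [r n - r m] is the squared distance of [s n] and [s m]. *)
Lemma riesz_fischer c (M : R[i]) : 0 <= M ->
  (forall n, \sum_(0 <= i < n) `|c i| ^+ 2 <= M ^+ 2) ->
  exists2 x, forall n, '[x, f n] = c n & `|x| <= M.
Proof.
move=> M0 cM.
pose s n := \sum_(0 <= i < n) c i *: f i.
(* Norms take values in [R[i]]; the real part is taken to have suprema at hand. *)
pose r n := complex.Re (\sum_(0 <= i < n) `|c i| ^+ 2).
have rE n : (r n)%:C%C = \sum_(0 <= i < n) `|c i| ^+ 2.
  by apply/RRe_real/ger0_real/sumr_ge0 => i _; rewrite exprn_ge0.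
have sB m n : (m <= n)%N -> `|s n - s m| ^+ 2 = (r n - r m)%:C%C.
  move=> mn; rewrite rmorphB /= !rE /s /= !(big_cat_nat (leq0n m) mn) /=.
  by rewrite ![_ + _ - _]addrAC !subrr !add0r norm_sum_orthonormal ?iota_uniq.
have r_ub : has_ubound (range r).
  exists (complex.Re (M ^+ 2)) => _ [n _ <-].
  by rewrite -lecR rE RRe_real ?ger0_real ?exprn_ge0.
have s_cauchy : cauchy (s @ \oo).
  apply: cauchy_exP => e e0.
  have e2 : (complex.Re (e ^+ 2))%:C%C = e ^+ 2.
    by rewrite RRe_real ?ger0_real// exprn_ge0// ltW.
  have e20 : 0 < complex.Re (e ^+ 2) by rewrite -ltcR e2 exprn_gt0.
  have [|_ [N _ <-] rN] := sup_adherent e20 (conj _ r_ub).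
    by exists (r 0%N), 0%N.
  exists (s N); exists N => // n /= Nn.
  rewrite -ball_normE /= distrC -(@ltr_pXn2r _ 2) ?nnegrE ?normr_ge0 ?(ltW e0)//.
  rewrite sB// -e2 ltcR ltrBlDl -ltrBlDr; apply: le_lt_trans rN.
  by rewrite lerD2r; apply: ub_le_sup => //; exists n.
have /cauchy_cvgP/cvg_ex[x /cvgrPdist_lt s_x] := s_cauchy.
exists x => [n|].
  apply/eqP; rewrite -subr_eq0 -normr_le0; apply/ler_addgt0Pr => d d0.
  have [N _ sN] := s_x d d0.
  have -> : c n = '[s (maxn N n.+1), f n].
    by rewrite inner_sum_orthonormal ?iota_uniq// mem_index_iota leq_max ltnSn orbT.
  rewrite -innerNl -innerDl (le_trans (cauchy_schwarz _ _))// add0r.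
  have -> : `|f n| = 1.
    by apply/eqP; rewrite -(@pexpr_eq1 _ _ 2)// -inner_normE f_on eqxx.
  by rewrite mulr1 ltW// sN//= leq_maxl.
apply/ler_addgt0Pl => d d0; have [N _ sN] := s_x d d0.
rewrite -[x](subrK (s N)) (le_trans (ler_normD _ _))// lerD ?(ltW (sN _ _))//=.
by rewrite -(@ler_pXn2r _ 2) ?nnegrE// norm_sum_orthonormal ?iota_uniq.
Qed.

End Bessel.

End InnerProduct.

(** * Closures of linear spans *)

Section Closure.
Context (R : realType) (H : hilbertType R).
Implicit Types (x y z : H) (B : set H).

Lemma closure_normP B x :
  closure B x <-> forall d, 0 < d -> exists2 y, B y & `|x - y| < d.
Proof.
split=> [Bx d d0|Bx A /nbhs_ballP[d d0 dA]].
  have [y [By]] := Bx _ (nbhsx_ballx x d d0).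
  by rewrite -ball_normE /= => xy; exists y.
have [y By xy] := Bx d d0; exists y; split=> //; apply: dA.
by rewrite -ball_normE.
Qed.

Lemma sub_linear_span B : B `<=` linear_span B.
Proof.
move=> x Bx; exists 1%N, (fun=> 1), (fun=> x); split=> //.
by rewrite big_ord1 scale1r.
Qed.

(** By continuity of [g]. This extends identities from a basis to the closed span. *)
Lemma functional0_closure_span B (g : H -> R[i]) (M : R[i]) :
  0 <= M -> (forall a x y, g (a *: x + y) = a * g x + g y) ->
  (forall x, `|g x| <= M * `|x|) -> (forall x, B x -> g x = 0) ->
  forall x, closure (linear_span B) x -> g x = 0.
Proof.
move=> M0 gL gM gB x /closure_normP Bx.
have gD u v : g (u + v) = g u + g v by rewrite -{1}[u]scale1r gL mul1r.
have g0 : g 0 = 0 by apply: (addrI (g 0)); rewrite -gD !addr0.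
have gZ a u : g (a *: u) = a * g u by rewrite -[_ *: _]addr0 gL g0 addr0.
have gspan y : linear_span B y -> g y = 0.
  move=> [n [a [b [Bb ->]]]].
  rewrite (big_morph g gD g0) big1// => i _.
  by rewrite gZ gB ?mulr0.
(* Unlike [M], [M + 1] is surely a legitimate divisor. *)
have M1 : 0 < M + 1 by rewrite ltr_wpDl.
apply/eqP; rewrite -normr_le0; apply/ler_addgt0Pr => d d0; rewrite add0r.
have [|y By xy] := Bx (d / (M + 1)); first by rewrite divr_gt0.
have := gD (x - y) y; rewrite subrK (gspan _ By) addr0 => ->.
apply: (le_trans (gM _)).
rewrite -[d](divfK (lt0r_neq0 M1)) [leRHS]mulrC.
by apply: ler_pM => //; [rewrite lerDl|exact: ltW].
Qed.

End Closure.

(** * Bounded operators and operators of rank one *)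

Section BoundedOperatorTheory.
Context (R : realType) (H : hilbertType R).
Implicit Types (x y z : H) (S T : bop H).

HB.instance Definition _ T := GRing.isLinear.Build R[i] H H *:%R T (bop_linear T).

Lemma bop_ext S T : (forall x, S x = T x) -> S = T.
Proof. by move=> ST; apply/val_inj/funext. Qed.

Lemma bop_addE S T x : (S + T) x = S x + T x.
Proof. by []. Qed.

Lemma bop_oppE T x : (- T) x = - T x.
Proof. by []. Qed.

Lemma bop_scaleE (a : R[i]) T x : (a *: T) x = a *: T x.
Proof. by []. Qed.

Lemma bop_scalerAl (a : R[i]) S T : a *: S * T = a *: (S * T).
Proof. exact: bop_ext. Qed.

Lemma bop_scalerAr (a : R[i]) S T : S * (a *: T) = a *: (S * T).
Proof. by apply: bop_ext => x; rewrite bopE !bop_scaleE linearZ. Qed.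

Lemma bop_bounded T : exists2 M : R[i], 0 <= M & forall x, `|T x| <= M * `|x|.
Proof.
have [_ [M TM]] := elimT (bounded_operatorP _) (bop_funP T).
exists `|M|%:C%C => [|x]; first by rewrite lecR.
by apply: (le_trans (TM x)); apply: ler_wpM2r => //; rewrite lecR ler_norm.
Qed.

Lemma bop_of_linear (F : H -> H) (M : R[i]) : linear F -> 0 <= M ->
  (forall x, `|F x| <= M * `|x|) -> exists T : bop H, forall x, T x = F x.
Proof.
move=> linF M0 FM.
suff Fb : F \in @bounded_operator R H by exists (Bop Fb).
apply/bounded_operatorP; split=> //; exists (complex.Re M) => x.
by rewrite RRe_real// ger0_real.
Qed.

Lemma outer_exists x y : exists T : bop H, forall z, T z = '[z, y] *: x.
Proof.
apply: (@bop_of_linear _ (`|x| * `|y|)) => [a u v||z].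
- by rewrite innerDl innerZl scalerDl scalerA.
- exact: mulr_ge0.
by rewrite normrZ mulrC -mulrA ler_wpM2l// mulrC cauchy_schwarz.
Qed.

Definition outer x y : bop H := sval (cid (outer_exists x y)).

Lemma outerE x y z : outer x y z = '[z, y] *: x.
Proof. by rewrite /outer; case: cid. Qed.

End BoundedOperatorTheory.

(** * Operators given by coordinates, and adjoints *)

Section CompleteOrthonormalSequence.
Context (R : realType) (H : hilbertType R).
Context (e : nat -> H) (e_complete : complete_orthonormal_seq e).
Implicit Types (x y z : H) (S T : bop H).

Let e_on : orthonormal_seq e := e_complete.1.

Lemma inner_complete_eq x y : (forall n, '[x, e n] = '[y, e n]) -> x = y.
Proof.
move=> xy; pose z := x - y.
have ze n : '[z, e n] = 0 by rewrite innerDl innerNl xy subrr.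
suff : z = 0 by move=> /eqP; rewrite subr_eq0 => /eqP.
apply: inner_extl => w; rewrite inner0l; apply: inner_eq0C.
apply: (@functional0_closure_span _ _ (range e) (fun w => '[w, z]) `|z|) => //.
- by move=> a u v; rewrite innerDl innerZl.
- by move=> u; rewrite mulrC cauchy_schwarz.
- by move=> _ [n _ <-]; apply: inner_eq0C.
by rewrite e_complete.2.
Qed.

(** Riesz-Fischer gives each value, and linearity follows as coordinates determine a vector. *)
Lemma bop_of_coords (F : H -> nat -> R[i]) (M : R[i]) : 0 <= M ->
  (forall n a x y, F (a *: x + y) n = a * F x n + F y n) ->
  (forall x n, \sum_(0 <= i < n) `|F x i| ^+ 2 <= (M * `|x|) ^+ 2) ->
  exists T : bop H, forall x n, '[T x, e n] = F x n.
Proof.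
move=> M0 linF FM.
have coord x : exists y, (forall n, '[y, e n] = F x n) /\ `|y| <= M * `|x|.
  by have [|y] := riesz_fischer e_on _ (FM x); [exact: mulr_ge0|exists y].
have [f f_coord] := choice coord.
have [T TE] : exists T : bop H, forall x, T x = f x.
  apply: (bop_of_linear _ M0) => [a x y|x]; last exact: (f_coord x).2.
  by apply: inner_complete_eq => n; rewrite innerDl innerZl !(f_coord _).1.
by exists T => x n; rewrite TE (f_coord x).1.
Qed.

Lemma bop_eq_on S T : (forall n, S (e n) = T (e n)) -> S = T.
Proof.
move=> ST; apply: bop_ext => x; apply: inner_extl => y.
pose D := S - T; have DE z : D z = S z - T z by [].
suff : '[D x, y] = 0.
  by rewrite DE innerDl innerNl => /eqP; rewrite subr_eq0 => /eqP.
have [M M0 DM] := bop_bounded D.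
apply: (@functional0_closure_span _ _ (range e) (fun x => '[D x, y]) (M * `|y|)).
- exact: mulr_ge0.
- by move=> a u v; rewrite linearP innerDl innerZl.
- move=> u; rewrite mulrAC (le_trans (cauchy_schwarz _ _))//.
  exact: ler_wpM2r.
- by move=> _ [n _ <-]; rewrite DE ST subrr inner0l.
by rewrite e_complete.2.
Qed.

Lemma adjoint_exists T : exists S : bop H, forall x y, '[T x, y] = '[x, S y].
Proof.
have [M M0 TM] := bop_bounded T.
have [S SE] : exists S : bop H, forall y n, '[S y, e n] = '[y, T (e n)].
  apply: (@bop_of_coords (fun y n => '[y, T (e n)]) M) => // [n a x y|y n].
    by rewrite innerDl innerZl.
  set F := fun n => '[y, T (e n)]; set w := \sum_(0 <= i < n) F i *: e i.
  have wE : `|w| ^+ 2 = \sum_(0 <= i < n) `|F i| ^+ 2.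
    by rewrite norm_sum_orthonormal ?iota_uniq.
  (* With Cauchy-Schwarz this yields [|w|^2 <= M |y| |w|], hence [|w| <= M |y|]. *)
  have yTw : '[y, T w] = `|w| ^+ 2.
    rewrite wE raddf_sum inner_sumr; apply: eq_bigr => i _.
    by rewrite /= linearZ innerZr mulrC normCK.
  rewrite -wE; have [->|w0] := eqVneq w 0.
    by rewrite normr0 expr0n exprn_ge0// mulr_ge0.
  have wM : `|w| <= M * `|y|.
    rewrite -(@ler_pM2r _ `|w|) ?normr_gt0// -expr2.
    rewrite -[leLHS]ger0_norm ?exprn_ge0// -yTw.
    rewrite (le_trans (cauchy_schwarz _ _))//.
    by rewrite [leRHS]mulrAC [leRHS]mulrC ler_wpM2l.
  by rewrite ler_pXn2r ?nnegrE ?mulr_ge0.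
exists S => x y.
suff : '[T x, y] - '[x, S y] = 0 by move=> /eqP; rewrite subr_eq0 => /eqP.
apply: (@functional0_closure_span _ _ (range e)
  (fun x => '[T x, y] - '[x, S y]) (M * `|y| + `|S y|)).
- by rewrite addr_ge0// mulr_ge0.
- move=> a u v; rewrite linearP !innerDl !innerZl /= mulrBr opprD.
  by rewrite addrACA.
- move=> u; rewrite mulrDl (le_trans (ler_normB _ _))// lerD//.
    rewrite mulrAC (le_trans (cauchy_schwarz _ _))//; exact: ler_wpM2r.
  by rewrite mulrC cauchy_schwarz.
- by move=> _ [n _ <-]; rewrite innerC -SE -innerC subrr.
by rewrite e_complete.2.
Qed.

Definition adjoint T : bop H := sval (cid (adjoint_exists T)).

Lemma adjointE T x y : '[T x, y] = '[x, adjoint T y].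
Proof. by rewrite /adjoint; case: cid. Qed.

Lemma adjointEr T x y : '[x, T y] = '[adjoint T x, y].
Proof. by rewrite innerC adjointE -innerC. Qed.

Lemma adjointM S T : adjoint (S * T) = adjoint T * adjoint S.
Proof.
apply: bop_ext => y; apply: inner_extl => x.
by rewrite bopE -!adjointEr.
Qed.

Lemma adjointK T : adjoint (adjoint T) = T.
Proof.
by apply: bop_ext => y; apply: inner_extl => x; rewrite -!adjointEr -adjointE.
Qed.

Lemma adjoint1 : adjoint 1 = 1.
Proof. by apply: bop_ext => y; apply: inner_extl => x; rewrite -!adjointEr. Qed.

Lemma adjointB S T : adjoint (S - T) = adjoint S - adjoint T.
Proof.
apply: bop_ext => y; apply: inner_extl => x.
rewrite -adjointEr !(bop_addE, bop_oppE) innerDl innerDr innerNl innerNr.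
by rewrite -!adjointEr.
Qed.

End CompleteOrthonormalSequence.

(** * Idempotents of infinite rank and corank *)

Section Bases.
Context (R : realType) (H : hilbertType R).
Context (e : nat -> H) (e_complete : complete_orthonormal_seq e).
Implicit Types (x y z : H) (S T Q : bop H) (B : set H).

Let e_on : orthonormal_seq e := e_complete.1.

(** [V] has the coordinates [<x, f n>], bounded by Bessel's inequality, and [U] is its adjoint. *)
Lemma isometry_exists (f : nat -> H) : orthonormal_seq f ->
  exists U V : bop H, [/\ V * U = 1, forall n, U (e n) = f n &
    forall x y, '[V x, y] = '[x, U y]].
Proof.
move=> f_on.
have [V VE] : exists V : bop H, forall x n, '[V x, e n] = '[x, f n].
  apply: (@bop_of_coords _ _ _ e_complete (fun x n => '[x, f n]) 1) => //.
    by move=> n a x y; rewrite innerDl innerZl.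
  by move=> x n; rewrite mul1r bessel ?iota_uniq.
pose U := adjoint e_complete V.
have Ue n : U (e n) = f n.
  by apply: inner_extl => y; rewrite -adjointEr innerC VE -innerC.
exists U, V; split=> //; last by move=> x y; exact: adjointE.
apply: (bop_eq_on e_complete) => n; apply: (inner_complete_eq e_complete) => m.
by rewrite bopE Ue VE f_on e_on.
Qed.

Lemma closure_range_idem Q : Q * Q = Q -> closure (range Q) = range Q.
Proof.
move=> QQ; apply/seteqP; split; last exact: subset_closure.
move=> y /closure_normP Qy; exists y => //.
have [M M0 QM] := bop_bounded Q.
apply/eqP; rewrite -subr_eq0 -normr_le0; apply/ler_addgt0Pr => d d0.
have M1 : 0 < M + 1 by rewrite ltr_wpDl.
have [|_ [w _ <-] yz] := Qy (d / (M + 1)); first by rewrite divr_gt0.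
have -> : Q y - y = Q (y - Q w) - (y - Q w).
  by rewrite linearB /= -bopE QQ opprB addrA subrK.
rewrite add0r (le_trans (ler_normB _ _))//.
apply: (@le_trans _ _ ((M + 1) * `|y - Q w|)).
  by rewrite mulrDl mul1r lerD2r.
by rewrite -[d](divfK (lt0r_neq0 M1)) mulrC ler_wpM2r ?ltW.
Qed.

Lemma isometry_range_closure (U V : bop H) (f : nat -> H) x : V * U = 1 ->
  (forall n, U (e n) = f n) -> (forall x y, '[V x, y] = '[x, U y]) ->
  closure (linear_span (range f)) (U x).
Proof.
move=> VU Ue UV; apply/closure_normP => d d0.
have : closure (linear_span (range e)) x by rewrite e_complete.2.
move=> /closure_normP/(_ d d0)[_ [n [a [b [eb ->]]]] xd].
exists (U (\sum_(i < n) a i *: b i)).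
  exists n, a, (fun i => U (b i)); split.
    by move=> i; have [m _ <-] := eb i; exists m => //; rewrite Ue.
  by rewrite raddf_sum; apply: eq_bigr => i _; rewrite /= linearZ.
(* [U] preserves norms, as [<U z, U z> = <V (U z), z> = <z, z>]. *)
rewrite -(@ltr_pXn2r _ 2) ?nnegrE ?(ltW d0)//.
rewrite -raddfB -inner_normE -UV -bopE VU inner_normE.
by rewrite ltr_pXn2r ?nnegrE ?(ltW d0).
Qed.

Lemma orthonormal_set_seq B (f : nat -> H) :
  orthonormal_set B -> (forall n, B (f n)) -> injective f -> orthonormal_seq f.
Proof. by move=> Bon Bf fI i j; rewrite Bon// (inj_eq fI). Qed.

(** Distinct elements of [B] have squared distance 2. *)
Lemma orthonormal_set_dist B x y :
  orthonormal_set B -> B x -> B y -> `|x - y| < 1 -> x = y.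
Proof.
move=> Bon Bx By; apply: contraTeq => xy; rewrite -real_leNgt ?ger0_real//.
rewrite -(@ler_pXn2r _ 2) ?nnegrE// expr1n -inner_normE.
rewrite innerDl !innerDr !innerNl !innerNr !Bon// !eqxx (negbTE xy).
by rewrite eq_sym (negbTE xy) oppr0 opprK addr0 add0r lerDl.
Qed.

(** Picking for each element a point of the dense set within 1/2 of it is injective on [B]. *)
Lemma orthonormal_set_countable B :
  separable_space H -> orthonormal_set B -> countable B.
Proof.
move=> [D /countable_injP[g gI] Dd] Bon.
have near x : exists y, D y /\ `|x - y| < 2^-1.
  have [|//|y [xy Dy]] := Dd (ball x 2^-1).
  - by exists x; apply: ballxx; rewrite invr_gt0.
  - exact: ball_open.
  by exists y; split=> //; move: xy; rewrite -ball_normE.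
have [h hP] := choice near.
apply/countable_injP; exists (g \o h) => x y; rewrite !inE => Bx By.
move=> /gI; rewrite !inE => /(_ (hP x).1 (hP y).1) hxy.
apply: (orthonormal_set_dist Bon) => //.
rewrite -[x](subrK (h x)) -addrA (le_lt_trans (ler_normD _ _))//.
rewrite [1](splitr 1) mul1r ltrD ?(hP x).2//.
by rewrite hxy distrC (hP y).2.
Qed.

Lemma orthonormal_set_enum B :
  separable_space H -> orthonormal_set B -> infinite_set B ->
  exists f : nat -> H, orthonormal_seq f /\ range f = B.
Proof.
move=> Hsep Bon Binf.
have := eq_card_nat (orthonormal_set_countable Hsep Bon) Binf.
rewrite card_eq_sym => /card_set_bijP[f [fB fI fS]].
exists f; split.
  apply: (orthonormal_set_seq Bon) => [n|i j ij]; first exact: fB.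
  by apply: fI; rewrite ?inE.
apply/seteqP; split=> [_ [n _ <-]|x /fS[n _ <-]]; first exact: fB.
by exists n.
Qed.

Lemma infinite_range_equiv1 Q : separable_space H -> Q * Q = Q ->
  infinite_dimension (range Q) -> equiv1 Q.
Proof.
move=> Hsep QQ [B [Bon QB] Binf].
have [f [f_on fB]] := orthonormal_set_enum Hsep Bon Binf.
have [U [V [VU Ue UV]]] := isometry_exists f_on.
have Qf n : Q (f n) = f n.
  have : range Q (f n).
    by rewrite -QB; apply/subset_closure/sub_linear_span; rewrite -fB; exists n.
  by move=> [x _ <-]; rewrite -bopE QQ.
have QU : Q * U = U.
  by apply: (bop_eq_on e_complete) => n; rewrite bopE Ue Qf.
(* [U * V] is the orthogonal projection onto the range of [Q], so [U * V * Q = Q], even for oblique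
   [Q]. *)
exists U, (V * Q); split; first by rewrite -mulrA QU VU.
have Vf n : V (f n) = e n by rewrite -Ue -bopE VU.
apply: bop_ext => x; apply: inner_extl => y.
pose D := U * V - 1; have DE z : D z = U (V z) - z by [].
have [M M0 DM] := bop_bounded D.
suff : '[D (Q x), y] = 0.
  by rewrite DE innerDl innerNl mulrA => /eqP; rewrite subr_eq0 => /eqP.
apply: (@functional0_closure_span _ _ (range f) (fun x => '[D x, y]) (M * `|y|)).
- exact: mulr_ge0.
- by move=> a u v; rewrite linearP innerDl innerZl.
- move=> u; rewrite mulrAC (le_trans (cauchy_schwarz _ _))//.
  exact: ler_wpM2r.
- by move=> _ [n _ <-]; rewrite DE Vf Ue subrr inner0l.
by rewrite fB QB; exists x.
Qed.

(** The matrix of inner products has more rows than columns, hence a nonzero vector in its left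
    kernel. *)
Lemma linear_dependence (n : nat) (g : 'I_n.+1 -> H) (b : 'I_n -> H) :
  exists2 v : 'I_n.+1 -> R[i], exists i, v i != 0 &
    forall j, '[\sum_i v i *: g i, b j] = 0.
Proof.
pose A : 'M[R[i]]_(n.+1, n) := \matrix_(i, j) '[g i, b j].
have : kermx A != 0.
  rewrite -mxrank_eq0 mxrank_ker -lt0n subn_gt0.
  by rewrite (leq_ltn_trans (rank_leq_col A)).
move=> /matrix0Pn[k [l kl]]; exists (fun i => kermx A k i); first by exists l.
move=> j; have /rowP/(_ j) : row k (kermx A) *m A = 0.
  by rewrite -row_mul mulmx_ker row0.
rewrite !mxE => <-; rewrite inner_suml; apply: eq_bigr => i _.
by rewrite innerZl !mxE.
Qed.

(** Zorn's lemma gives a maximal orthonormal set [B] in the range. Were it finite, some nonzero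
    combination of the independent vectors [U (e i)] would be orthogonal to it. *)
Lemma equiv1_infinite_range Q : separable_space H -> Q * Q = Q ->
  equiv1 Q -> infinite_dimension (range Q).
Proof.
move=> Hsep QQ [U [V [VU UVQ]]].
have Qrange y : range Q y -> Q y = y by move=> [x _ <-]; rewrite -bopE QQ.
pose P B := B `<=` range Q /\ orthonormal_set B.
have [|B [[BQ Bon] Bmax]] := @Zorn_bigcup _ P.
  move=> F FP Ftot; split; first by move=> x [A FA Ax]; exact: (FP _ FA).1.
  move=> x y [A FA Ax] [A' FA' Ay].
  case: (Ftot _ _ FA FA') => AA.
    by apply: (FP _ FA').2 => //; exact: AA.
  by apply: (FP _ FA).2 => //; exact: AA.
have max_orth y : range Q y -> (forall b, B b -> '[y, b] = 0) -> y = 0.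
  move=> Qy yB; apply/eqP/negPn/negP => y0.
  have ny : `|y| != 0 by rewrite normr_eq0.
  pose u := `|y|^-1 *: y.
  have uu : '[u, u] = 1.
    by rewrite inner_normE normrZ normfV normr_id mulVf// expr1n.
  have uB b : B b -> '[u, b] = 0 by move=> Bb; rewrite innerZl yB// mulr0.
  have nBu : ~ B u by move=> /uB; rewrite uu => /eqP; rewrite oner_eq0.
  apply: (Bmax (B `|` [set u])); first split.
  - by left.
  - by move=> /(_ u (or_intror erefl)).
  split=> [b [/BQ//|->]|b c].
    by exists u => //; rewrite linearZ /= Qrange.
  have bu b' : B b' -> (b' == u) = false by apply: contraPF => /eqP ->.
  move=> [Bb|->] [Bc|->].
  - exact: Bon.
  - by rewrite bu// inner_eq0C// uB.
  - by rewrite eq_sym bu// uB.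
  - by rewrite uu eqxx.
have Binf : infinite_set B.
  move=> /finite_seqP[s Bs].
  pose g (i : 'I_(size s).+1) := U (e i).
  have [v [i vi] vs] := linear_dependence g (fun j : 'I_(size s) => s`_j).
  pose y := \sum_i v i *: g i.
  have yE : y = U (\sum_i v i *: e i).
    by rewrite raddf_sum; apply: eq_bigr => j _; rewrite /= linearZ.
  have y0 : y = 0.
    apply: max_orth => [|b].
      exists y => //; rewrite yE -bopE -UVQ -mulrA VU mulr1 //.
    rewrite Bs /= => bs; have bi : (index b s < size s)%N by rewrite index_mem.
    by rewrite -(nth_index 0 bs) -[index b s]/(nat_of_ord (Ordinal bi)).
  move: vi; have : '[V y, e i] = 0 by rewrite y0 raddf0 inner0l.
  rewrite yE -bopE VU inner_suml (bigD1 i)//= innerZl e_on eqxx mulr1.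
  rewrite big1 ?addr0 => [->|j ji]; first by rewrite eqxx.
  by rewrite innerZl e_on (inj_eq (@ord_inj _)) (negbTE ji) mulr0.
exists B => //; split=> //.
have span_sub : closure (linear_span B) `<=` range Q.
  rewrite -(closure_range_idem QQ); apply: closureS.
  move=> _ [n [a [b [Bb ->]]]]; exists (\sum_(i < n) a i *: b i) => //.
  rewrite raddf_sum; apply: eq_bigr => i _ /=.
  by rewrite linearZ /= Qrange//; exact/BQ.
apply/seteqP; split=> // y Qy.
have [f [f_on fB]] := orthonormal_set_enum Hsep Bon Binf.
have [W [X [XW We WX]]] := isometry_exists f_on.
have Wcl x : closure (linear_span B) (W x).
  by rewrite -fB; apply: isometry_range_closure XW We WX.
(* [W (X y)] is the orthogonal projection of [y] onto the closed span of [B], so the difference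
   falls under maximality. *)
suff : y - W (X y) = 0 by move=> /eqP; rewrite subr_eq0 => /eqP ->.
apply: max_orth.
  by exists (y - W (X y)) => //; rewrite linearB /= !Qrange//; exact: span_sub.
move=> b; rewrite -{1}fB => -[n _ <-].
rewrite -We -WX linearB /= -[X (W _)]bopE XW.
by rewrite subrr inner0l.
Qed.

(** Both sides are the kernel of the adjoint of [Q]. *)
Lemma orthogonal_complement_range Q : Q * Q = Q ->
  orthogonal_complement (range Q) = range (1 - adjoint e_complete Q).
Proof.
move=> QQ; set Q' := adjoint e_complete Q.
have Q'Q' : Q' * Q' = Q' by rewrite -adjointM QQ.
have E z : (1 - Q') z = z - Q' z by [].
apply/seteqP; split=> [y Qy|_ [z _ <-] _ [x _ <-]].
  exists y => //; rewrite E (_ : Q' y = 0) ?subr0//.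
  apply: inner_extl => x; rewrite inner0l -adjointEr.
  by apply/inner_eq0C/Qy; exists x.
by rewrite E (adjointE e_complete) linearB /= -[Q' (Q' _)]bopE Q'Q' subrr inner0r.
Qed.

Lemma equiv1_adjoint Q : equiv1 Q -> equiv1 (adjoint e_complete Q).
Proof.
move=> [U [V [VU <-]]]; exists (adjoint e_complete V), (adjoint e_complete U).
by rewrite -!adjointM VU adjoint1.
Qed.

(** The corank of [Q] is the rank of the adjoint of [1 - Q], and [equiv1] is stable under
    adjoints. *)
Lemma idempotent_inf_rank_corankP Q : separable_space H ->
  idempotent_inf_rank_corank Q <-> biequiv1 Q.
Proof.
move=> Hsep; rewrite /idempotent_inf_rank_corank /idempotent_bop expr2.
have adjE S : S * S = S -> (1 - adjoint e_complete S) * (1 - adjoint e_complete S) =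
    1 - adjoint e_complete S.
  move=> SS; have {}SS : adjoint e_complete S * adjoint e_complete S =
    adjoint e_complete S by rewrite -adjointM SS.
  by rewrite mulrBl mul1r mulrBr mulr1 SS subrr subr0.
have adj1 S : adjoint e_complete (1 - S) = 1 - adjoint e_complete S.
  by rewrite adjointB adjoint1.
split=> [[QQ Qr Qc]|[Q1 Q2]].
  split; first by apply: infinite_range_equiv1; rewrite // -closure_range_idem.
  rewrite -(adjointK e_complete (1 - Q)); apply: equiv1_adjoint; rewrite adj1.
  apply: infinite_range_equiv1 => //; first exact: adjE.
  by rewrite -orthogonal_complement_range// -closure_range_idem.
have QQ := equiv1_idem Q1; split=> //.
  by rewrite /infinite_rank closure_range_idem//; exact: equiv1_infinite_range.
rewrite /infinite_corank closure_range_idem// orthogonal_complement_range//.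
apply: equiv1_infinite_range => //; first exact: adjE.
by rewrite -adj1; exact: equiv1_adjoint.
Qed.

End Bases.

(** * A Cuntz pair in B(H) and infinite direct sums of an operator *)

Section CuntzPair.
Context (R : realType) (H : hilbertType R).
Context (e : nat -> H) (e_complete : complete_orthonormal_seq e).
Implicit Types (x y z : H) (S T : bop H).

Let e_on : orthonormal_seq e := e_complete.1.

(** The isometries send [e n] to [e n.*2] and to [e n.*2.+1]. [D] is the coordinatewise limit of
    iterates [Dn], started at 0, of the map whose fixed point is sought. *)
Lemma cuntz_pair_exists : exists s1 s2 t1 t2 : bop H,
  cuntz_pair s1 s2 t1 t2 /\
  forall T, exists D : bop H, D = s1 * T * t1 + s2 * D * t2.
Proof.
have [s1 [t1 [ts1 s1e st1]]] : exists U V : bop H, [/\ V * U = 1,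
    forall n, U (e n) = e n.*2 & forall x y, '[V x, y] = '[x, U y]].
  apply: (isometry_exists e_complete) => i j; rewrite e_on.
  by rewrite (inj_eq double_inj).
have [s2 [t2 [ts2 s2e st2]]] : exists U V : bop H, [/\ V * U = 1,
    forall n, U (e n) = e n.*2.+1 & forall x y, '[V x, y] = '[x, U y]].
  apply: (isometry_exists e_complete) => i j; rewrite e_on.
  by rewrite eqSS (inj_eq double_inj).
have t1s2 : t1 * s2 = 0.
  apply: (bop_eq_on e_complete) => n; apply: (inner_complete_eq e_complete) => m.
  rewrite bopE st1 s1e s2e e_on inner0l; case: eqP => // /(congr1 odd).
  by rewrite /= !odd_double.
have t2s1 : t2 * s1 = 0.
  apply: (bop_eq_on e_complete) => n; apply: (inner_complete_eq e_complete) => m.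
  rewrite bopE st2 s1e s2e e_on inner0l; case: eqP => // /(congr1 odd).
  by rewrite /= !odd_double.
have st1' x y : '[s1 x, y] = '[x, t1 y] by rewrite innerC -st1 -innerC.
have st2' x y : '[s2 x, y] = '[x, t2 y] by rewrite innerC -st2 -innerC.
have t1e m : t1 (e m) = if odd m then 0 else e m./2.
  rewrite -[m in LHS]odd_double_half; case: odd; rewrite ?add1n ?add0n.
    by rewrite -s2e -bopE t1s2.
  by rewrite -s1e -bopE ts1.
have t2e m : t2 (e m) = if odd m then e m./2 else 0.
  rewrite -[m in LHS]odd_double_half; case: odd; rewrite ?add1n ?add0n.
    by rewrite -s2e -bopE ts2.
  by rewrite -s1e -bopE t2s1.
have stD : s1 * t1 + s2 * t2 = 1.
  apply: (bop_eq_on e_complete) => m; rewrite bop_addE !bopE t1e t2e.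
  rewrite -[m in RHS]odd_double_half; case: odd; rewrite ?add1n ?add0n.
    by rewrite raddf0 add0r s2e.
  by rewrite raddf0 addr0 s1e.
exists s1, s2, t1, t2; split=> // T.
have coordE (a b : bop H) x m : '[(s1 * a * t1 + s2 * b * t2) x, e m] =
    if odd m then '[b (t2 x), e m./2] else '[a (t1 x), e m./2].
  rewrite bop_addE innerDl !bopE st1' st2' t1e t2e.
  by case: odd; rewrite inner0r ?add0r ?addr0.
have normE (u v : H) : `|s1 u + s2 v| ^+ 2 = `|u| ^+ 2 + `|v| ^+ 2.
  rewrite normD_orth; last by rewrite st1' -bopE t1s2 inner0r.
  by rewrite -!inner_normE st1' st2' -!bopE ts1 ts2.
have xE x : `|x| ^+ 2 = `|t1 x| ^+ 2 + `|t2 x| ^+ 2.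
  by rewrite -normE -!bopE -bop_addE stD.
have [M M0 TM] := bop_bounded T.
pose Dn n : bop H := iter n (fun D : bop H => s1 * T * t1 + s2 * D * t2) 0.
(* The bound of [T] survives each iteration, as the ranges of [s1] and [s2] are orthogonal and [xE]
   splits the norm of [x]. *)
have DnM n x : `|Dn n x| <= M * `|x|.
  elim: n x => [|n IH] x; first by rewrite normr0 mulr_ge0.
  rewrite -(@ler_pXn2r _ 2) ?nnegrE ?mulr_ge0//.
  rewrite [Dn _]iterS -/(Dn n) bop_addE !bopE normE.
  rewrite exprMn [X in _ <= _ * X]xE mulrDr.
  by rewrite -!exprMn lerD// ler_pXn2r ?nnegrE ?mulr_ge0.
(* An even coordinate comes from [T] alone; an odd [m] is reduced to the smaller coordinate [m./2]
   of the preceding iterate. *)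
have Dn_stable m n x : (m < n)%N -> '[Dn n x, e m] = '[Dn m.+1 x, e m].
  elim/ltn_ind: m n x => m IH [//|n] x mn.
  rewrite [Dn n.+1]iterS -/(Dn n) [Dn m.+1]iterS -/(Dn m) !coordE.
  case: ifPn => // om.
  have mm : (m./2 < m)%N by rewrite -divn2 ltn_Pdiv//; case: m om {IH mn}.
  by rewrite !(IH _ mm)// (leq_trans mm).
have [D DE] : exists D : bop H, forall x n, '[D x, e n] = '[Dn n.+1 x, e n].
  apply: (@bop_of_coords _ _ _ e_complete (fun x n => '[Dn n.+1 x, e n]) M) => //.
    by move=> n a x y; rewrite linearP innerDl innerZl.
  move=> x n; apply: (@le_trans _ _ (`|Dn n x| ^+ 2)); last first.
    by rewrite ler_pXn2r ?nnegrE ?mulr_ge0.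
  apply: le_trans (bessel e_on (Dn n x) (iota_uniq 0 (n - 0))).
  rewrite big_seq [leRHS]big_seq ler_sum// => i.
  by rewrite mem_iota subn0 => /andP[_ iN]; rewrite (Dn_stable i n).
exists D; apply: bop_ext => x; apply: (inner_complete_eq e_complete) => m.
rewrite coordE DE [Dn m.+1]iterS -/(Dn m) coordE; case: ifPn => // om.
rewrite DE Dn_stable//; by rewrite -divn2 ltn_Pdiv//; case: m om.
Qed.

Lemma bop_torsion_free T : T + T = 0 -> T = 0.
Proof.
rewrite -mulr2n -scaler_nat => /eqP; rewrite scaler_eq0 pnatr_eq0 /=.
by move=> /eqP.
Qed.

End CuntzPair.

(** * The transpose as an antiautomorphism *)

Section Transpose.
Context (R : realType) (H : hilbertType R).
Context (e : nat -> H) (e_complete : complete_orthonormal_seq e).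
Implicit Types (x y z : H) (S T : bop H).

Let e_on : orthonormal_seq e := e_complete.1.

Lemma basis_conj_exists x :
  exists y, (forall n, '[y, e n] = '[x, e n]^*) /\ `|y| <= `|x|.
Proof.
have [//||y] := @riesz_fischer _ _ _ e_on (fun n => '[x, e n]^*) `|x|.
  move=> n; under eq_bigr do rewrite norm_conjC.
  by rewrite bessel ?iota_uniq.
by exists y.
Qed.

(** The antilinear involution conjugating coordinates; the transpose of [T] is its adjoint
    conjugated by this involution. *)
Definition basis_conj x : H := sval (cid (basis_conj_exists x)).

Lemma basis_conjE x n : '[basis_conj x, e n] = '[x, e n]^*.
Proof. by rewrite /basis_conj; case: cid => ? []. Qed.

Lemma basis_conj_le x : `|basis_conj x| <= `|x|.
Proof. by rewrite /basis_conj; case: cid => ? []. Qed.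

Lemma basis_conjP (a : R[i]) x y :
  basis_conj (a *: x + y) = a^* *: basis_conj x + basis_conj y.
Proof.
apply: (inner_complete_eq e_complete) => n.
by rewrite innerDl innerZl !basis_conjE innerDl innerZl rmorphD rmorphM.
Qed.

Lemma basis_conjK : involutive basis_conj.
Proof.
move=> x; apply: (inner_complete_eq e_complete) => n.
by rewrite !basis_conjE conjCK.
Qed.

Lemma basis_conj_e n : basis_conj (e n) = e n.
Proof.
apply: (inner_complete_eq e_complete) => m.
by rewrite basis_conjE e_on; case: eqP; rewrite ?conjC1 ?conjC0.
Qed.

Lemma basis_conj_transpose T : exists S : bop H,
  forall x, S x = basis_conj (adjoint e_complete T (basis_conj x)).
Proof.
have [M M0 TM] := bop_bounded (adjoint e_complete T).
apply: (@bop_of_linear _ _ _ M) => // [a x y|x].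
  by rewrite basis_conjP linearP basis_conjP conjCK.
rewrite (le_trans (basis_conj_le _))// (le_trans (TM _))// ler_wpM2l//.
exact: basis_conj_le.
Qed.

Lemma bop_transposeE T i j : '[bop_transpose e T (e i), e j] = '[T (e j), e i].
Proof.
have [S SE] := basis_conj_transpose T.
have : exists S : bop H,
    [set S : bop H | forall i j, '[S (e i), e j] = '[T (e j), e i]] S.
  exists S => i' j' /=; rewrite SE basis_conj_e basis_conjE.
  by rewrite -innerC -adjointE.
by move=> /(xgetPex 0)/(_ i j).
Qed.

Lemma bop_transpose_uniq S T :
  (forall i j, '[S (e i), e j] = '[T (e j), e i]) -> S = bop_transpose e T.
Proof.
move=> ST; apply: (bop_eq_on e_complete) => i.
by apply: (inner_complete_eq e_complete) => j; rewrite ST bop_transposeE.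
Qed.

Lemma bop_transpose_conj T x :
  bop_transpose e T x = basis_conj (adjoint e_complete T (basis_conj x)).
Proof.
have [S SE] := basis_conj_transpose T.
rewrite -SE; congr (bop_fun _ x); apply/esym/bop_transpose_uniq => i j.
by rewrite SE basis_conj_e basis_conjE -innerC -adjointE.
Qed.

Lemma bop_transpose_linear : linear (bop_transpose e).
Proof.
move=> a S T; apply/esym/bop_transpose_uniq => i j.
rewrite !bop_addE !bop_scaleE !innerDl !innerZl.
by rewrite !bop_transposeE.
Qed.

Lemma bop_transposeM S T :
  bop_transpose e (S * T) = bop_transpose e T * bop_transpose e S.
Proof.
apply: bop_ext => x.
by rewrite bopE !bop_transpose_conj basis_conjK adjointM.
Qed.

Lemma bop_transposeK : involutive (bop_transpose e).
Proof.
by move=> T; apply/esym/bop_transpose_uniq => i j; rewrite bop_transposeE.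
Qed.

Lemma bop_transpose_outer n :
  bop_transpose e (outer (e n) (e n)) = outer (e n) (e n).
Proof.
apply/esym/bop_transpose_uniq => i j; rewrite !outerE !innerZl !e_on.
by rewrite mulrC [n == i]eq_sym [n == j]eq_sym.
Qed.

End Transpose.

(** * Jordan automorphisms of the algebra of bounded operators *)

Section BoundedIntertwiners.
Context (R : realType) (H : hilbertType R).
Context (e : nat -> H) (e_complete : complete_orthonormal_seq e).
Implicit Types (x y z : H) (S T : bop H).

Let e_on : orthonormal_seq e := e_complete.1.

(** If [T x] is nonzero, taking for [X] the operator [outer y (T x)] gives [|T x|^2 S y = 0]. *)
Lemma bop_prime S T : (forall X : bop H, S * X * T = 0) -> S = 0 \/ T = 0.
Proof.
move=> ST; have [->|/eqP T0] := eqVneq T 0; first by right.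
left; have [x Tx] : exists x, T x <> 0.
  apply: contrapT => /forallNP h; apply: T0; apply: bop_ext => x.
  exact: (contrapT (h x)).
apply: bop_ext => y; have := congr1 (fun X : bop H => X x) (ST (outer y (T x))).
rewrite !bopE outerE linearZ => /eqP.
rewrite scaler_eq0 inner_normE sqrf_eq0 normr_eq0.
by case: eqP => //= _ /eqP.
Qed.

(* An unbounded [A] has vectors [y n] with [|y n| <= 2^-n] and
   [n * |A (e n)| < |A (y n)|]; the operator mapping [e n] to [y n] is bounded,
   and no bounded [S] satisfies [S (A (e n)) = A (y n)] for all [n]. *)
Lemma intertwiner_bounded (A : {linear H -> H}) :
  (forall T, exists S, forall x, S (A x) = A (T x)) ->
  exists2 M : R[i], 0 <= M & forall x, `|A x| <= M * `|x|.
Proof.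
move=> AT; apply: contrapT => /forall2NP unbounded.
pose h : R[i] := 2^-1.
have h0 : 0 < h by rewrite invr_gt0.
have vec n : exists y, `|y| <= h ^+ n /\ n%:R * `|A (e n)| < `|A y|.
  (* A vector with [|A x| > K |x|], scaled to norm [h ^+ n], is as required. *)
  pose K := n%:R * `|A (e n)| / h ^+ n.
  have K0 : 0 <= K by rewrite divr_ge0 ?mulr_ge0 ?exprn_ge0 ?(ltW h0).
  have [//|/existsNP[x]] := unbounded K.
  have Kx_real : K * `|x| \is Num.real by apply/ger0_real/mulr_ge0.
  move=> /negP; rewrite -real_ltNge ?normr_real// => Kx.
  have x0 : x != 0 by apply: contraTneq Kx => ->; rewrite raddf0 !normr0 mulr0 ltxx.
  have nx : 0 < `|x| by rewrite normr_gt0.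
  exists ((h ^+ n / `|x|) *: x); split.
    rewrite normrZ normrM normfV normr_id divfK ?gt_eqF//.
    by rewrite ger0_norm ?exprn_ge0 ?(ltW h0).
  rewrite linearZ normrZ normrM normfV normr_id (ger0_norm (exprn_ge0 _ (ltW h0))).
  rewrite mulrAC ltr_pdivlMr// -ltr_pdivrMl ?exprn_gt0//.
  by rewrite [X in X < _]mulrC mulrAC; exact: Kx.
have [y yP] := choice vec.
(* The partial sums stay below 2, so those of the squared coordinates [|<x, y i>|^2] stay below
   [2 |x|^2]. *)
have geo n : \sum_(0 <= i < n) h ^+ i + 2 * h ^+ n = 2.
  elim: n => [|n IH]; first by rewrite big_geq// add0r expr0 mulr1.
  rewrite big_nat_recr//= -[RHS]IH -addrA; congr (_ + _).
  by rewrite exprS mulrA divff ?mul1r ?pnatr_eq0// mulr_natl mulr2n.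
have [S SE] : exists S : bop H, forall x n, '[S x, e n] = '[x, y n].
  apply: (@bop_of_coords _ _ _ e_complete (fun x n => '[x, y n]) 2) => //.
    by move=> n a u v; rewrite innerDl innerZl.
  move=> x n; apply: (@le_trans _ _ (\sum_(0 <= i < n) h ^+ i * `|x| ^+ 2)).
    apply: ler_sum => i _; apply: (@le_trans _ _ ((h ^+ i * `|x|) ^+ 2)).
      rewrite ler_pXn2r ?nnegrE ?mulr_ge0 ?exprn_ge0 ?(ltW h0)//.
      by rewrite (le_trans (cauchy_schwarz _ _))// mulrC ler_wpM2r// (yP i).1.
    rewrite exprMn ler_wpM2r ?exprn_ge0// expr2 ler_piMl ?exprn_ge0 ?(ltW h0)//.
    by rewrite exprn_ile1 ?(ltW h0)// invf_le1 ?ler1n.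
  rewrite -mulr_suml exprMn ler_wpM2r ?exprn_ge0//.
  apply: (@le_trans _ _ 2); last by rewrite -natrX ler_nat.
  by rewrite -[leRHS](geo n) lerDl mulr_ge0 ?exprn_ge0 ?(ltW h0).
pose T := adjoint e_complete S.
have Te n : T (e n) = y n.
  by apply: inner_extl => x; rewrite -adjointEr innerC SE -innerC.
have [X XA] := AT T; have [M M0 XM] := bop_bounded X.
have [n Mn] : exists n : nat, M <= n%:R.
  exists (Num.bound (complex.Re M)).
  rewrite -[M]RRe_real ?ger0_real// -(rmorph_nat (real_complex R)) lecR ltW//.
  apply: le_lt_trans (archi_boundP _) => //.
  by rewrite -lecR RRe_real ?ger0_real.
(* As [M <= n], [|A (y n)| = |X (A (e n))| <= n |A (e n)|], against the choice of [y n]. *)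
have := lt_le_trans (yP n).2 (_ : _ <= n%:R * `|A (e n)|).
rewrite ltxx -Te -XA => /(_ (le_trans (XM _) _)) bad.
by apply: (notF (bad _)); rewrite ler_wpM2r.
Qed.

End BoundedIntertwiners.


(** * Jordan automorphisms and a rank one projection *)

Section JordanAutomorphism.
Context (R : realType) (H : hilbertType R).
Context (e : nat -> H) (e_complete : complete_orthonormal_seq e).
Implicit Types (x y z : H) (S T X Y : bop H).

Let e_on : orthonormal_seq e := e_complete.1.

Local Notation p := (outer (e 0%N) (e 0%N)).

Lemma outer_sandwich T : p * T * p = '[T (e 0%N), e 0%N] *: p.
Proof.
apply: bop_ext => x; rewrite !bopE bop_scaleE !outerE linearZ innerZl.
by rewrite scalerA mulrC.
Qed.

Lemma outer_idem : p * p = p.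
Proof. by have := outer_sandwich 1; rewrite mulr1 e_on eqxx scale1r. Qed.

Lemma outer_neq0 : p != 0.
Proof.
apply/eqP => /(congr1 (fun X : bop H => '[X (e 0%N), e 0%N])).
by rewrite outerE innerZl !e_on inner0l eqxx mulr1 => /eqP; rewrite oner_eq0.
Qed.

Lemma outer_neq1 : p != 1.
Proof.
apply/eqP => /(congr1 (fun X : bop H => '[X (e 1%N), e 1%N])).
rewrite outerE innerZl !e_on mul0r => /eqP.
by rewrite eq_sym [X in X == _](_ : _ = 1) ?oner_eq0// e_on.
Qed.

Lemma outer_mull T x y : T * outer x y = outer (T x) y.
Proof. by apply: bop_ext => z; rewrite bopE !outerE linearZ. Qed.

Context (phi : {linear bop H -> bop H}) (phi_bij : bijective phi).
Hypothesis phiJ : forall S T, phi (S * T + T * S) = phi S * phi T + phi T * phi S.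

Let phi_surj S : exists T, phi T = S.
Proof. by have [psi _ phiK] := phi_bij; exists (psi S). Qed.

Let phi_compression S : phi (p * S * p) = phi p * phi S * phi p.
Proof. exact: (jordan_compression phiJ (@bop_torsion_free R H) outer_idem). Qed.

Let phi_p_minimal S T X : S * phi p * T = 0 -> S * (phi p * X * phi p) * T = 0.
Proof.
have [Y <-] := phi_surj X => ST.
rewrite -phi_compression outer_sandwich linearZ.
by rewrite bop_scalerAr bop_scalerAl ST scaler0.
Qed.

Lemma jordan_rank1_dichotomy :
  ((forall X, p * X = 0 /\ X * p = X -> phi p * phi X = 0) /\
   (forall Y, p * Y = Y /\ Y * p = 0 -> phi Y * phi p = 0)) \/
  ((forall X, p * X = 0 /\ X * p = X -> phi X * phi p = 0) /\
   (forall Y, p * Y = Y /\ Y * p = 0 -> phi p * phi Y = 0)).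
Proof.
exact: (@jordan_dichotomy _ phi (bij_inj phi_bij) phi_surj phiJ
  (@bop_torsion_free R H) _ outer_idem (@bop_prime R H) phi_p_minimal
  outer_neq0 outer_neq1).
Qed.

Hypothesis phi_column :
  forall X, p * X = 0 /\ X * p = X -> phi p * phi X = 0.
Hypothesis phi_row :
  forall Y, p * Y = Y /\ Y * p = 0 -> phi Y * phi p = 0.

Let phi_mulr_p S : phi (S * p) = phi S * phi p.
Proof.
exact: (@jordan_mulr_idem _ phi phiJ (@bop_torsion_free R H) _ outer_idem
  phi_column phi_row).
Qed.

Let phi_mul_column S X : X * p = X -> phi (S * X) = phi S * phi X.
Proof.
have p_minimal Y T : Y * p = Y -> phi (Y * (p * T * p)) = phi Y * phi (p * T * p).
  move=> Yp; rewrite outer_sandwich bop_scalerAr Yp !linearZ bop_scalerAr.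
  by rewrite -phi_mulr_p Yp.
exact: (@jordan_mul_column _ phi phiJ (@bop_torsion_free R H) _ outer_idem
  phi_column phi_row p_minimal).
Qed.

Theorem jordan_automorphism_inner :
  exists A Ainv : bop H, (A * Ainv = 1 /\ Ainv * A = 1) /\
    forall T, phi T = A * T * Ainv.
Proof.
have phi_p0 : phi p != 0.
  apply: contraNneq outer_neq0 => q0; apply/eqP/(bij_inj phi_bij).
  by rewrite q0 raddf0.
have [v /eqP qv] : exists v, phi p v <> 0.
  apply: contrapT => /forallNP h; move/eqP: phi_p0; apply; apply: bop_ext => v.
  exact: (contrapT (h v)).
set x0 := phi p v in qv.
have qx0 : phi p x0 = x0 by rewrite /x0 -bopE -phi_mulr_p outer_idem.
pose a x := phi (outer x (e 0%N)) x0.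
have a_lin : linear a.
  move=> c x y; rewrite /a -bop_scaleE -bop_addE -linearP.
  congr (phi _ x0); apply: bop_ext => z.
  by rewrite bop_addE bop_scaleE !outerE scalerDr !scalerA mulrC.
have aT T x : phi T (a x) = a (T x).
  rewrite /a -bopE -phi_mul_column ?outer_mull//.
  by rewrite outerE e_on eqxx scale1r.
have ae0 : a (e 0%N) = x0 by [].
pose aL : {linear H -> H} := HB.pack a (GRing.isLinear.Build _ _ _ _ a a_lin).
have a_inj : injective a.
  suff a0 x : a x = 0 -> x = 0.
    move=> x y axy; apply/eqP; rewrite -subr_eq0; apply/eqP/a0.
    by rewrite -[a]/(aL : _ -> _) linearB /= axy subrr.
  move=> ax; apply/eqP; apply: contraNT qv => x_neq0.
  rewrite -ae0.
  (* An operator sending [x] to [e 0] turns [a x = 0] into [x0 = a (e 0) = 0]. *)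
  have -> : e 0%N = outer ((`|x| ^+ 2)^-1 *: e 0%N) x x.
    rewrite outerE inner_normE scalerA divff ?scale1r//.
    by rewrite sqrf_eq0 normr_eq0.
  by rewrite -aT ax raddf0.
have a_surj y : exists x, a x = y.
  (* [phi T] sends [x0 = a (e 0)] to [y], so [T (e 0)] is a preimage of [y]. *)
  have [T TE] := phi_surj (outer ((`|x0| ^+ 2)^-1 *: y) x0).
  exists (T (e 0%N)); rewrite -aT ae0 TE outerE inner_normE scalerA divff ?scale1r//.
  by rewrite sqrf_eq0 normr_eq0.
have [b ab] := choice a_surj.
have ba x : b (a x) = x by apply: a_inj; rewrite ab.
have b_lin : linear b by move=> c x y; apply: a_inj; rewrite a_lin !ab.
pose bL : {linear H -> H} := HB.pack b (GRing.isLinear.Build _ _ _ _ b b_lin).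
have [M M0 aM] : exists2 M : R[i], 0 <= M & forall x, `|aL x| <= M * `|x|.
  by apply: (intertwiner_bounded e_complete) => T; exists (phi T).
have [N N0 bN] : exists2 M : R[i], 0 <= M & forall x, `|bL x| <= M * `|x|.
  (* The inverse [b] intertwines as well, with preimages under [phi] as partners. *)
  apply: (intertwiner_bounded e_complete) => T; have [S ST] := phi_surj T.
  by exists S => x; apply: a_inj; rewrite -aT !ab ST.
have [A AE] := bop_of_linear a_lin M0 aM.
have [B BE] := bop_of_linear b_lin N0 bN.
exists A, B; split.
  by split; apply: bop_ext => x; rewrite bopE AE BE ?ab ?ba.
by move=> T; apply: bop_ext => y; rewrite !bopE AE BE -aT ab.
Qed.

End JordanAutomorphism.

Theorem theorem2 (R : realType) (H : hilbertType R)
    (H_separable : separable_space H)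
    (H_infinite : infinite_dimension [set: H])
    (e : nat -> H) (e_complete : complete_orthonormal_seq e)
    (phi : {linear bop H -> bop H}) (phi_bij : bijective phi)
    (phi_preserves : forall P : bop H,
       idempotent_inf_rank_corank P <-> idempotent_inf_rank_corank (phi P)) :
  exists A Ainv : bop H, (A * Ainv = 1 /\ Ainv * A = 1) /\
    ((forall T : bop H, phi T = A * T * Ainv) \/
     (forall T : bop H, phi T = A * bop_transpose e T * Ainv)).
Proof.
have [s1 [s2 [t1 [t2 [st diagP]]]]] := cuntz_pair_exists e_complete.
have phi_bi P : biequiv1 P -> biequiv1 (phi P).
  have I Q := idempotent_inf_rank_corankP e_complete Q H_separable.
  by move=> /I/phi_preserves/I.
have phiJ S T : phi (S * T + T * S) = phi S * phi T + phi T * phi S.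
  exact: (jordan_of_biequiv1 st diagP (@bop_torsion_free R H) phi_bi).
have [[hc hr]|[hc hr]] := jordan_rank1_dichotomy e_complete phi_bij phiJ.
  have [A [B [AB phiE]]] := jordan_automorphism_inner e_complete phi_bij phiJ hc hr.
  by exists A, B; split=> //; left.
(* In the second alternative, the transpose reverses products and fixes the rank one projection, so
   it swaps columns and rows, and [phi \o tr] falls under the first alternative. *)
pose tr := bop_transpose e.
have trM := bop_transposeM e_complete.
have trp := bop_transpose_outer e_complete 0%N.
have trK := bop_transposeK e_complete.
have tr_lin := bop_transpose_linear e_complete.
have trD S T : tr (S + T) = tr S + tr T.
  by have := tr_lin 1 S T; rewrite !scale1r.
have psi_lin : linear (phi \o tr).
  by move=> c S T; rewrite /= /tr tr_lin linearP.
pose psi : {linear bop H -> bop H} :=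
  HB.pack (phi \o tr) (GRing.isLinear.Build _ _ _ _ (phi \o tr) psi_lin).
have psiE T : psi T = phi (tr T) by [].
have psi_bij : bijective psi.
  by apply: bij_comp => //; exists tr.
have psiJ S T : psi (S * T + T * S) = psi S * psi T + psi T * psi S.
  by rewrite !psiE trD /tr !trM phiJ addrC.
have tr0 : tr 0 = 0 by apply: (addrI (tr 0)); rewrite -trD !addr0.
have psi_p : psi (outer (e 0%N) (e 0%N)) = phi (outer (e 0%N) (e 0%N)).
  by rewrite psiE /tr trp.
have [X [pX Xp]|Y [pY Yp]|A [B [AB psi_inner]]] :=
    jordan_automorphism_inner e_complete psi_bij psiJ.
- rewrite psi_p; apply: hr; rewrite -trp -!trM.
  by rewrite Xp pX.
- rewrite psi_p; apply: hc; rewrite -trp -!trM.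
  by rewrite pY Yp.
exists A, B; split=> //; right => T.
by rewrite -psi_inner psiE /tr trK.
Qed.
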